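(* Let $R$ be a commutative Noetherian ring with derived category $\mathcal{D}=D(R)$. Let $\mathcal{L}$ be a smashing subcategory of $\mathcal{D}$, and let $\gamma:\mathcal{D}\to\mathcal{L}$ be a right adjoint functor to the natural embedding $\iota:\mathcal{L}\hookrightarrow\mathcal{D}$. Let $X, I$ be chain complexes in $\mathcal{D}$ and let $n$ be an integer such that: (1) $I$ is a bounded complex of injective $R$-modules with $I^i=0$ for all $i>n$; (2) $\sigma_{\leqq -1}X\in\mathcal{L}$. Then the natural (counit) map $\gamma I\to I$ induces an isomorphism in $\mathcal{D}$ $$\sigma_{>n}\,\mathrm{RHom}_R(X,\gamma I)\;\cong\;\sigma_{>n}\,\mathrm{RHom}_R(X,I).$$
   Context: $D(R)$ is the full (unbounded) derived category of $R$-modules; complexes are written cohomologically, $X=(\cdots\to X^n\xrightarrow{d^n}X^{n+1}\to\cdots)$. The small support of $X\in D(R)$ is $\mathrm{supp}(X)=\{\mathfrak{p}\in\mathrm{Spec}(R) : X\otimes^{\mathrm L}_R\kappa(\mathfrak{p})\neq 0\}$, where $\kappa(\mathfrak{p})=R_{\mathfrak p}/\mathfrak pR_{\mathfrak p}$. For $W\subseteq\mathrm{Spec}(R)$, put $\mathcal{L}_W=\{X\in D(R) : \mathrm{supp}(X)\subseteq W\}$; this is a localizing subcategory (a triangulated full subcategory closed under direct sums and direct summands). A localizing subcategory is called smashing if it is of the form $\mathcal{L}_W$ with $W$ specialization-closed (i.e. $\mathfrak p\in W$ and $\mathfrak p\subseteq\mathfrak q$ imply $\mathfrak q\in W$); in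 that case $\gamma$ is the local cohomology functor $\mathrm{R}\Gamma_W$, and $X\in\mathcal{L}_W$ if and only if $\mathrm{Supp}\,H^i(X)\subseteq W$ for all $i\in\mathbb{Z}$. Truncations: $\sigma_{>n}X=(\cdots\to 0\to\mathrm{Im}\,d^n\to X^{n+1}\xrightarrow{d^{n+1}}X^{n+2}\to\cdots)$ and $\sigma_{\leqq n}X=(\cdots\to X^{n-2}\to X^{n-1}\to\mathrm{Ker}\,d^n\to 0\to\cdots)$. *)

(* Defs.v *)
From HB Require Import structures.
From mathcomp Require Import all_boot all_order all_algebra.
From mathcomp Require Import boolp classical_sets.
From mathcomp Require Import zify ring.

Set Implicit Arguments.
Unset Strict Implicit.
Unset Printing Implicit Defensive.

Import Order.TTheory GRing.Theory Num.Theory.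
Local Open Scope ring_scope.

Lemma linear_ext (R : pzRingType) (U V : lmodType R) (f g : {linear U -> V}) :
  f =1 g -> f = g.
Proof.
case: f g => f Hf [g Hg] /= /funext Efg; move: Hf; rewrite Efg => Hf.
congr GRing.Linear.Pack.
case: Hf Hg => [[Hf1] [Hf2]] [[Hg1] [Hg2]].
by rewrite (Prop_irrelevance Hf1 Hg1) (Prop_irrelevance Hf2 Hg2).
Qed.

Definition mklin (R : pzRingType) (U V : lmodType R) (f : U -> V)
    (linf : linear f) : {linear U -> V} :=
  HB.pack f (GRing.isLinear.Build R U V *:%R f linf).

Record submodule (R : pzRingType) (V : lmodType R) := Submodule {
  submodule_set :> V -> Prop;
  submodule0 : submodule_set 0;
  submoduleP : forall (a : R) (u v : V),
    submodule_set u -> submodule_set v -> submodule_set (a *: u + v) }.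

Section SubmoduleType.
Variables (R : pzRingType) (V : lmodType R) (S : submodule V).

Definition submodule_pred : {pred V} := fun x => `[< S x >].

Lemma submodule_pred_closed : submod_closed submodule_pred.
Proof.
split=> [|a u v]; first exact/asboolP/submodule0.
by move=> /asboolP Su /asboolP Sv; apply/asboolP/submoduleP.
Qed.
HB.instance Definition _ :=
  GRing.isSubmodClosed.Build R V submodule_pred submodule_pred_closed.

Definition submodule_type := {x : V | submodule_pred x}.
HB.instance Definition _ := SubChoice.on submodule_type.
HB.instance Definition _ := [SubChoice_isSubLmodule of submodule_type by <:].

Definition to_submodule (x : V) (Sx : S x) : submodule_type :=
  exist _ x (introT (asboolP _) Sx).

Lemma submodule_typeP (x : submodule_type) : S (val x).
Proof. exact/asboolP/(valP x). Qed.
End SubmoduleType.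

Definition submodule_lmod (R : pzRingType) (V : lmodType R) (S : submodule V)
  : lmodType R := submodule_type S.

Definition restrict (R : pzRingType) (V V' : lmodType R) (S : submodule V)
    (S' : submodule V') (f : {linear V -> V'})
    (Sf : forall x, S x -> S' (f x)) :
  {linear submodule_lmod S -> submodule_lmod S'}.
Proof.
apply: (@mklin R _ _ (fun x : submodule_type S =>
  to_submodule (Sf (val x) (submodule_typeP x)) : submodule_lmod S')).
by move=> a x y; apply: val_inj; rewrite /= !linearP.
Defined.

Definition prod_lmod (R : pzRingType) (U V : lmodType R) : lmodType R :=
  (U * V)%type.

Definition injective_module (R : pzRingType) (E : lmodType R) : Prop :=
  forall (M N : lmodType R) (j : {linear M -> N}) (f : {linear M -> E}),
    injective j -> exists g : {linear N -> E}, forall x, g (j x) = f x.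

(* The module axioms hold up to the congruence pm_rel. *)
Record premodule (R : pzRingType) := Premodule {
  pm_sort : choiceType;
  pm_rel : pm_sort -> pm_sort -> Prop;
  pm_zero : pm_sort;
  pm_opp : pm_sort -> pm_sort;
  pm_add : pm_sort -> pm_sort -> pm_sort;
  pm_scale : R -> pm_sort -> pm_sort;
  pm_refl : forall x, pm_rel x x;
  pm_sym : forall x y, pm_rel x y -> pm_rel y x;
  pm_trans : forall x y z, pm_rel x y -> pm_rel y z -> pm_rel x z;
  pm_oppE : forall x y, pm_rel x y -> pm_rel (pm_opp x) (pm_opp y);
  pm_addE : forall x x' y y', pm_rel x x' -> pm_rel y y' ->
    pm_rel (pm_add x y) (pm_add x' y');
  pm_scaleE : forall a x y, pm_rel x y -> pm_rel (pm_scale a x) (pm_scale a y);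
  pm_addA : forall x y z,
    pm_rel (pm_add x (pm_add y z)) (pm_add (pm_add x y) z);
  pm_addC : forall x y, pm_rel (pm_add x y) (pm_add y x);
  pm_add0 : forall x, pm_rel (pm_add pm_zero x) x;
  pm_addN : forall x, pm_rel (pm_add (pm_opp x) x) pm_zero;
  pm_scaleA : forall a b x,
    pm_rel (pm_scale a (pm_scale b x)) (pm_scale (a * b) x);
  pm_scale1 : forall x, pm_rel (pm_scale 1 x) x;
  pm_scaleDr : forall a x y,
    pm_rel (pm_scale a (pm_add x y)) (pm_add (pm_scale a x) (pm_scale a y));
  pm_scaleDl : forall a b x,
    pm_rel (pm_scale (a + b) x) (pm_add (pm_scale a x) (pm_scale b x)) }.

Section PremoduleQuotient.
Variables (R : pzRingType) (M : premodule R).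
Local Open Scope quotient_scope.

Definition pm_eqv : rel (pm_sort M) := fun x y => `[< pm_rel x y >].
Lemma pm_eqv_equiv : equiv_class_of pm_eqv.
Proof.
split=> [x|x y|y x z]; first exact/asboolP/pm_refl.
  by apply/asboolP/asboolP; exact: pm_sym.
by move=> /asboolP xy /asboolP yz; apply/asboolP/(pm_trans xy yz).
Qed.
Canonical pm_equiv_rel := EquivRelPack pm_eqv_equiv.

Definition pm_quot := {eq_quot pm_eqv}.
HB.instance Definition _ := Choice.on pm_quot.
HB.instance Definition _ := EqQuotient.on pm_quot.

Definition pm_pi (x : pm_sort M) : pm_quot := \pi x.

Lemma pm_piP x y : pm_pi x = pm_pi y <-> pm_rel x y.
Proof.
split=> [/eqquotP/asboolP //|xy]; exact/eqquotP/asboolP.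
Qed.

Lemma pm_reprP x : pm_rel (repr (pm_pi x)) x.
Proof. by apply/pm_piP; rewrite /pm_pi reprK. Qed.

Definition pmq_add (u v : pm_quot) := pm_pi (pm_add (repr u) (repr v)).
Definition pmq_opp (u : pm_quot) := pm_pi (pm_opp (repr u)).
Definition pmq_scale a (u : pm_quot) := pm_pi (pm_scale a (repr u)).

Lemma pmq_addE x y : pmq_add (pm_pi x) (pm_pi y) = pm_pi (pm_add x y).
Proof. by apply/pm_piP/pm_addE; apply: pm_reprP. Qed.
Lemma pmq_oppE x : pmq_opp (pm_pi x) = pm_pi (pm_opp x).
Proof. by apply/pm_piP/pm_oppE/pm_reprP. Qed.
Lemma pmq_scaleE a x : pmq_scale a (pm_pi x) = pm_pi (pm_scale a x).
Proof. by apply/pm_piP/pm_scaleE/pm_reprP. Qed.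

Lemma pm_quotW (P : pm_quot -> Prop) : (forall x, P (pm_pi x)) -> forall u, P u.
Proof. by move=> Ppi u; rewrite -[u]reprK; apply: Ppi. Qed.

Lemma pmq_addA : associative pmq_add.
Proof.
elim/pm_quotW => x; elim/pm_quotW => y; elim/pm_quotW => z.
by rewrite !pmq_addE; apply/pm_piP/pm_addA.
Qed.
Lemma pmq_addC : commutative pmq_add.
Proof.
elim/pm_quotW => x; elim/pm_quotW => y.
by rewrite !pmq_addE; apply/pm_piP/pm_addC.
Qed.
Lemma pmq_add0 : left_id (pm_pi (pm_zero M)) pmq_add.
Proof.
by elim/pm_quotW => x; rewrite !pmq_addE; apply/pm_piP/pm_add0.
Qed.
Lemma pmq_addN : left_inverse (pm_pi (pm_zero M)) pmq_opp pmq_add.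
Proof.
by elim/pm_quotW => x; rewrite pmq_oppE !pmq_addE; apply/pm_piP/pm_addN.
Qed.
HB.instance Definition _ :=
  GRing.isZmodule.Build pm_quot pmq_addA pmq_addC pmq_add0 pmq_addN.

Lemma pmq_scaleA a b u : pmq_scale a (pmq_scale b u) = pmq_scale (a * b) u.
Proof.
by elim/pm_quotW: u => x; rewrite !pmq_scaleE; apply/pm_piP/pm_scaleA.
Qed.
Lemma pmq_scale1 : left_id 1 pmq_scale.
Proof. by elim/pm_quotW => x; rewrite !pmq_scaleE; apply/pm_piP/pm_scale1. Qed.
Lemma pmq_scaleDr : right_distributive pmq_scale +%R.
Proof.
move=> a; elim/pm_quotW => x; elim/pm_quotW => y.
rewrite [X in pmq_scale a X]pmq_addE !pmq_scaleE [RHS]pmq_addE.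
exact/pm_piP/pm_scaleDr.
Qed.
Lemma pmq_scaleDl u : {morph pmq_scale^~ u : a b / a + b}.
Proof.
elim/pm_quotW: u => x a b.
rewrite /= !pmq_scaleE [RHS]pmq_addE; exact/pm_piP/pm_scaleDl.
Qed.
HB.instance Definition _ := GRing.Zmodule_isLmodule.Build R pm_quot
  pmq_scaleA pmq_scale1 pmq_scaleDr pmq_scaleDl.

Definition pm_lmod : lmodType R := pm_quot.
End PremoduleQuotient.

(* Formal sums of pure tensors m (x) n, modulo the congruence generated by
   bilinearity. *)
Section TensorRel.
Variables (R : comPzRingType) (M N : lmodType R).

Inductive tensor_rel : seq (M * N) -> seq (M * N) -> Prop :=
| tensor_refl s : tensor_rel s s
| tensor_sym s t : tensor_rel s t -> tensor_rel t s
| tensor_trans s t u : tensor_rel s t -> tensor_rel t u -> tensor_rel s u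
| tensor_cat s s' t t' : tensor_rel s s' -> tensor_rel t t' ->
    tensor_rel (s ++ t) (s' ++ t')
| tensor_comm s t : tensor_rel (s ++ t) (t ++ s)
| tensor_addl m m' n : tensor_rel [:: (m + m', n)] [:: (m, n); (m', n)]
| tensor_addr m n n' : tensor_rel [:: (m, n + n')] [:: (m, n); (m, n')]
| tensor_scale a m n : tensor_rel [:: (a *: m, n)] [:: (m, a *: n)]
| tensor_zero n : tensor_rel [:: (0, n)] [::].

End TensorRel.

Definition tensor_mapl (R : comPzRingType) (M M' N : lmodType R) (f : M -> M')
  (s : seq (M * N)) : seq (M' * N) := [seq (f x.1, x.2) | x <- s].

Lemma tensor_maplE (R : comPzRingType) (M M' N : lmodType R)
    (f : {linear M -> M'}) (s t : seq (M * N)) :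
  tensor_rel s t -> tensor_rel (tensor_mapl f s) (tensor_mapl f t).
Proof.
elim=> {s t} [s|s t _|s t u _ st _|s s' t t' _ ss' _ tt'|s t|m m' n|m n n'
  |a m n|n] /=.
- exact: tensor_refl.
- exact: tensor_sym.
- exact: tensor_trans.
- by rewrite /tensor_mapl !map_cat; apply: tensor_cat.
- by rewrite /tensor_mapl !map_cat; apply: tensor_comm.
- by rewrite linearD; apply: tensor_addl.
- exact: tensor_addr.
- by rewrite linearZ; apply: tensor_scale.
- by rewrite linear0; apply: tensor_zero.
Qed.

Section Tensor.
Variables (R : comPzRingType) (M N : lmodType R).

Lemma tensor_maplC (f g : M -> M) (s : seq (M * N)) :
  (forall m (n : N), tensor_rel [:: (f m, n); (g m, n)] [::]) ->
  tensor_rel (tensor_mapl f s ++ tensor_mapl g s) [::].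
Proof.
move=> fg; elim: s => [|[m n] s IH]; first exact: tensor_refl.
rewrite /= -cat1s -[(g m, n) :: _]cat1s.
apply: (tensor_trans (t := ([:: (f m, n)] ++ [:: (g m, n)]) ++
          (tensor_mapl f s ++ tensor_mapl g s))).
  rewrite -!catA; apply: tensor_cat; first exact: tensor_refl.
  rewrite !catA; apply: tensor_cat; last exact: tensor_refl.
  exact: tensor_comm.
rewrite -[X in tensor_rel _ X]cats0.
by apply: tensor_cat; [exact: fg | exact: IH].
Qed.

Lemma tensor_maplD (f g h : M -> M) (s : seq (M * N)) :
  (forall m (n : N), tensor_rel [:: (h m, n)] [:: (f m, n); (g m, n)]) ->
  tensor_rel (tensor_mapl h s) (tensor_mapl f s ++ tensor_mapl g s).
Proof.
move=> fgh; elim: s => [|[m n] s IH]; first exact: tensor_refl.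
rewrite /= -cat1s -[(f m, n) :: _]cat1s -[(g m, n) :: _]cat1s.
apply: (tensor_trans (t := ([:: (f m, n)] ++ [:: (g m, n)]) ++
          (tensor_mapl f s ++ tensor_mapl g s))).
  by apply: tensor_cat; [exact: fgh | exact: IH].
rewrite -!catA; apply: tensor_cat; first exact: tensor_refl.
rewrite !catA; apply: tensor_cat; last exact: tensor_refl.
exact: tensor_comm.
Qed.

Definition tensor_premodule : premodule R.
Proof.
pose opp : {linear M -> M} := -%R.
pose scale (a : R) : {linear M -> M} := a \*: (@idfun M : {linear M -> M}).
apply: (@Premodule R (seq (M * N) : choiceType) (@tensor_rel R M N) [::]
  (tensor_mapl opp) cat (fun a => tensor_mapl (scale a))).
- exact: tensor_refl.
- exact: tensor_sym.
- exact: tensor_trans.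
- exact: tensor_maplE.
- exact: tensor_cat.
- by move=> a; exact: tensor_maplE.
- by move=> x y z; rewrite catA; apply: tensor_refl.
- exact: tensor_comm.
- exact: tensor_refl.
- move=> s; rewrite -[X in _ ++ X](_ : tensor_mapl idfun s = s); last first.
    by rewrite /tensor_mapl -[RHS]map_id; apply: eq_map => -[].
  apply: tensor_maplC => m n.
  apply: tensor_trans (tensor_sym (tensor_addl _ _ _)) _.
  by rewrite /= addNr; apply: tensor_zero.
- move=> a b s; rewrite /tensor_mapl -map_comp.
  rewrite (eq_map (g := fun x => (scale (a * b) x.1, x.2))); last first.
    by case=> m n /=; rewrite scalerA.
  exact: tensor_refl.
- move=> s; rewrite /tensor_mapl (eq_map (g := id)) ?map_id.
    exact: tensor_refl.
  by case=> m n /=; rewrite scale1r.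
- by move=> a s t; rewrite /tensor_mapl map_cat; apply: tensor_refl.
- move=> a b s; apply: tensor_maplD => m n /=.
  by rewrite scalerDl; apply: tensor_addl.
Defined.

Definition tensor : lmodType R := pm_lmod tensor_premodule.


End Tensor.

Definition tensor_map (R : comPzRingType) (M M' N : lmodType R)
  (f : {linear M -> M'}) : {linear tensor M N -> tensor M' N}.
Proof.
apply: (@mklin R _ _ (fun u : pm_quot (tensor_premodule M N) =>
  pm_pi (M := tensor_premodule M' N) (tensor_mapl f (repr u)) : tensor M' N)).
move=> a; elim/pm_quotW => x; elim/pm_quotW => y.
rewrite [a *: pm_pi x]pmq_scaleE [_ + pm_pi y]pmq_addE.
rewrite [a *: pm_pi _]pmq_scaleE [RHS]pmq_addE; apply/pm_piP.
apply: (@tensor_trans R M' N _ _ _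
  (tensor_maplE f (pm_reprP (M := tensor_premodule M N) _))).
rewrite /tensor_mapl /= map_cat; apply: tensor_cat; last first.
  exact/(tensor_maplE f)/tensor_sym/(pm_reprP y).
rewrite /tensor_mapl -map_comp.
apply: (@tensor_trans _ _ _ _ (tensor_mapl (fun m => f (a *: m)) x)).
  exact: tensor_refl.
pose fa : {linear M -> M'} := f \o (a \*: (@idfun M : {linear M -> M})).
apply: tensor_trans (tensor_maplE fa (tensor_sym (pm_reprP x))) _.
rewrite /tensor_mapl (eq_map (g := fun x => (a *: f x.1, x.2))).
  by rewrite -map_comp; apply: tensor_refl.
by case=> m n /=; rewrite linearZ.
Defined.

Notation ideal R := (submodule R^o).

Definition noetherian (R : pzRingType) : Prop :=
  forall I : ideal R, exists s : seq R, forall x : R,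
    I x <-> exists c : nat -> R, x = \sum_(i < size s) c i * s`_i.

Record Spec (R : comPzRingType) := PrimeIdeal {
  prime_ideal :> ideal R;
  prime_proper : ~ prime_ideal 1;
  prime_mul : forall x y : R,
    prime_ideal (x * y) -> prime_ideal x \/ prime_ideal y }.

(* kappa(p) as an R-module: fractions a / s with s outside p.  Since p is
   prime, a / s and b / t in R_p are congruent modulo p R_p if and only if
   a t - b s belongs to p. *)
Section ResidueField.
Variables (R : comPzRingType) (p : Spec R).
Implicit Types (a b c : R).

Definition outside := {s : R | ~~ submodule_pred p s}.

Lemma outsideP (s : outside) : ~ p (val s).
Proof. by move=> ps; case/negP: (valP s); apply/asboolP. Qed.

Definition to_outside (s : R) (ps : ~ p s) : outside :=
  exist _ s (introN (asboolP _) ps).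

Definition outside1 : outside := to_outside (@prime_proper R p).
Definition outsideM (s t : outside) : outside :=
  to_outside (fun pst : p (val s * val t) =>
    or_ind (@outsideP s) (@outsideP t) (prime_mul pst)).

Definition residue_rel (x y : R * outside) : Prop :=
  p (x.1 * val y.2 - y.1 * val x.2).

Lemma ideal_lin a b x y : p x -> p y -> p (a * x + b * y).
Proof.
move=> px py; have pby : p (b * y).
  by rewrite -[_ * _]addr0; apply: (submoduleP (s := p)) => //; apply: submodule0.
exact: (submoduleP (s := p) a px pby).
Qed.

Lemma ideal_eq0 x : x = 0 -> p x.
Proof. by move->; exact: submodule0. Qed.

Definition residue_premodule : premodule R.
Proof.
apply: (@Premodule R (R * outside : choiceType)%type residue_rel (0, outside1)
  (fun x => (- x.1, x.2))
  (fun x y => (x.1 * val y.2 + y.1 * val x.2, outsideM x.2 y.2))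
  (fun a x => (a * x.1, x.2))); rewrite /residue_rel /=.
- by move=> x; apply: ideal_eq0; ring.
- move=> x y pxy; have /= := ideal_lin (-1) 0 pxy pxy.
  by congr (p _); ring.
- move=> [a s] [b t] [c u] /= ab bc.
  have := ideal_lin (val u) (val s) ab bc.
  have -> : val u * (a * val t - b * val s) + val s * (b * val u - c * val t)
    = (a * val u - c * val s) * val t by ring.
  by case/prime_mul => // /outsideP.
- move=> x y pxy; have /= := ideal_lin (-1) 0 pxy pxy.
  by congr (p _); ring.
- move=> [a s] [a' s'] [b t] [b' t'] /= paa' pbb'.
  have /= := ideal_lin (val t * val t') (val s * val s') paa' pbb'.
  by congr (p _); ring.
- move=> c x y pxy; have /= := ideal_lin c 0 pxy pxy.
  by congr (p _); ring.
- by move=> x y z; apply: ideal_eq0; ring.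
- by move=> x y; apply: ideal_eq0; ring.
- by move=> x; apply: ideal_eq0; ring.
- by move=> x; apply: ideal_eq0; ring.
- by move=> a b x; apply: ideal_eq0; ring.
- by move=> x; apply: ideal_eq0; ring.
- by move=> a x y; apply: ideal_eq0; ring.
- by move=> a b x; apply: ideal_eq0; ring.
Defined.

Definition residue_field : lmodType R := pm_lmod residue_premodule.
End ResidueField.

(* The differential is given between all pairs of degrees, and vanishes
   unless the target degree is one above the source degree. *)
Record cpx (R : pzRingType) := Cpx {
  term :> int -> lmodType R;
  diff : forall i j : int, {linear term i -> term j};
  diff_shape : forall (i j : int) (x : term i), j != i + 1 -> diff i j x = 0;
  diffK : forall (i j k : int) (x : term i), diff j k (diff i j x) = 0 }.
Arguments diff {R} c i j.

Record cmap (R : pzRingType) (X Y : cpx R) := Cmap {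
  cmap_fun :> forall i : int, {linear X i -> Y i};
  cmap_diff : forall (i j : int) (x : X i),
    cmap_fun j (diff X i j x) = diff Y i j (cmap_fun i x) }.

Section Complexes.
Variable R : pzRingType.
Implicit Types X Y Z : cpx R.

Definition cmap_id X : cmap X X.
Proof. by exists (fun i => idfun : {linear X i -> X i}). Defined.

Definition cmap_comp X Y Z (g : cmap Y Z) (f : cmap X Y) : cmap X Z.
Proof.
exists (fun i => g i \o f i : {linear X i -> Z i}).
by move=> i j x /=; rewrite !cmap_diff.
Defined.

Definition cycle X (i : int) (x : X i) : Prop := diff X i (i + 1) x = 0.
Definition boundary X (i : int) (x : X i) : Prop :=
  exists (j : int) (y : X j), diff X j i y = x.

Definition acyclic X : Prop :=
  forall (i : int) (x : X i), cycle x -> boundary x.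

(* H^i(f) is injective and surjective for every i. *)
Definition quasi_iso X Y (f : cmap X Y) : Prop := forall i : int,
  (forall x : X i, cycle x -> boundary (f i x) -> boundary x) /\
  (forall y : Y i, cycle y ->
     exists2 x : X i, cycle x & boundary (y - f i x)).

Definition bounded X : Prop :=
  exists a b : int, forall i : int, i < a \/ b < i -> forall x : X i, x = 0.

End Complexes.

(* Equality of morphisms is a specified congruence. *)
Record category := Category {
  ob :> Type;
  hom : ob -> ob -> Type;
  heq : forall a b, hom a b -> hom a b -> Prop;
  idm : forall a, hom a a;
  compose : forall a b c, hom b c -> hom a b -> hom a c;
  heq_refl : forall a b (f : hom a b), heq f f;
  heq_sym : forall a b (f g : hom a b), heq f g -> heq g f;
  heq_trans : forall a b (f g h : hom a b), heq f g -> heq g h -> heq f h;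
  compose_heq : forall a b c (g g' : hom b c) (f f' : hom a b),
    heq g g' -> heq f f' -> heq (compose g f) (compose g' f');
  compose_idl : forall a b (f : hom a b), heq (compose (idm b) f) f;
  compose_idr : forall a b (f : hom a b), heq (compose f (idm a)) f;
  composeA : forall a b c e (h : hom c e) (g : hom b c) (f : hom a b),
    heq (compose h (compose g f)) (compose (compose h g) f) }.
Arguments hom {c} a b : rename.
Arguments heq {c a b} f g : rename.
Arguments idm {c} a : rename.
Arguments compose {c a b e} g f : rename.

Record functor (C C' : category) := Functor {
  fob :> C -> C';
  fmap : forall a b : C, hom a b -> hom (fob a) (fob b);
  fmap_heq : forall (a b : C) (f g : hom a b),
    heq f g -> heq (fmap f) (fmap g);
  fmap_id : forall a : C, heq (fmap (idm a)) (idm (fob a));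
  fmap_comp : forall (a b c : C) (g : hom b c) (f : hom a b),
    heq (fmap (compose g f)) (compose (fmap g) (fmap f)) }.
Arguments fmap {C C'} F {a b} f : rename.

Definition isomorphism (C : category) (a b : C) (f : hom a b) : Prop :=
  exists g : hom b a,
    heq (compose g f) (idm a) /\ heq (compose f g) (idm b).

(* F is left adjoint to G. *)
Record adjunction (C C' : category) (F : functor C C') (G : functor C' C) :=
Adjunction {
  adj_unit : forall a : C, hom a (G (F a));
  counit : forall b : C', hom (F (G b)) b;
  adj_unit_nat : forall (a a' : C) (f : hom a a'),
    heq (compose (fmap G (fmap F f)) (adj_unit a)) (compose (adj_unit a') f);
  counit_nat : forall (b b' : C') (g : hom b b'),
    heq (compose g (counit b)) (compose (counit b') (fmap F (fmap G g)));
  triangleF : forall a : C,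
    heq (compose (counit (F a)) (fmap F (adj_unit a))) (idm (F a));
  triangleG : forall b : C',
    heq (compose (fmap G (counit b)) (adj_unit (G b))) (idm (G b)) }.
Arguments adj_unit {C C' F G} _ a : rename.
Arguments counit {C C' F G} _ b : rename.

Definition full_subcategory (C : category) (L : C -> Prop) : category :=
  @Category {a : C | L a} (fun a b => hom (sval a) (sval b))
    (fun _ _ => heq) (fun a => idm (sval a)) (fun _ _ _ => compose)
    (fun _ _ => @heq_refl C _ _) (fun _ _ => @heq_sym C _ _)
    (fun _ _ => @heq_trans C _ _) (fun _ _ _ => @compose_heq C _ _ _)
    (fun _ _ => @compose_idl C _ _) (fun _ _ => @compose_idr C _ _)
    (fun _ _ _ _ => @composeA C _ _ _ _).

Definition embedding (C : category) (L : C -> Prop) :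
  functor (full_subcategory L) C :=
  @Functor (full_subcategory L) C sval (fun _ _ f => f) (fun _ _ _ _ e => e)
    (fun _ => heq_refl _) (fun _ _ _ _ _ => heq_refl _).

(* D(R) is the localization of the category of complexes at the
   quasi-isomorphisms: morphisms are formal composites of chain maps and of
   inverses of quasi-isomorphisms, and their equality is the congruence
   generated by composition of chain maps and by the inversion relations. *)
Section DerivedCategory.
Variable R : pzRingType.

Inductive dhom : cpx R -> cpx R -> Type :=
| dhom_id X : dhom X X
| dhom_comp X Y Z : dhom Y Z -> dhom X Y -> dhom X Z
| dhom_map X Y : cmap X Y -> dhom X Y
| dhom_inv X Y (s : cmap X Y) : quasi_iso s -> dhom Y X.

Inductive deq : forall X Y, dhom X Y -> dhom X Y -> Prop :=
| deq_refl X Y (f : dhom X Y) : deq f f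
| deq_sym X Y (f g : dhom X Y) : deq f g -> deq g f
| deq_trans X Y (f g h : dhom X Y) : deq f g -> deq g h -> deq f h
| deq_comp X Y Z (g g' : dhom Y Z) (f f' : dhom X Y) :
    deq g g' -> deq f f' -> deq (dhom_comp g f) (dhom_comp g' f')
| deq_idl X Y (f : dhom X Y) : deq (dhom_comp (dhom_id Y) f) f
| deq_idr X Y (f : dhom X Y) : deq (dhom_comp f (dhom_id X)) f
| deq_assoc X Y Z T (h : dhom Z T) (g : dhom Y Z) (f : dhom X Y) :
    deq (dhom_comp h (dhom_comp g f)) (dhom_comp (dhom_comp h g) f)
| deq_map X Y (f g : cmap X Y) :
    (forall i, f i =1 g i) -> deq (dhom_map f) (dhom_map g)
| deq_map_id X : deq (dhom_map (cmap_id X)) (dhom_id X)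
| deq_map_comp X Y Z (g : cmap Y Z) (f : cmap X Y) :
    deq (dhom_map (cmap_comp g f)) (dhom_comp (dhom_map g) (dhom_map f))
| deq_invl X Y (s : cmap X Y) (qs : quasi_iso s) :
    deq (dhom_comp (dhom_inv qs) (dhom_map s)) (dhom_id X)
| deq_invr X Y (s : cmap X Y) (qs : quasi_iso s) :
    deq (dhom_comp (dhom_map s) (dhom_inv qs)) (dhom_id Y).

Definition D : category :=
  Category deq_refl deq_sym deq_trans deq_comp deq_idl deq_idr deq_assoc.

Section Extension.
Variables (F : cpx R -> cpx R) (Fm : forall X Y, cmap X Y -> cmap (F X) (F Y)).
Hypothesis Fm_ext : forall X Y (f g : cmap X Y),
  (forall i, f i =1 g i) -> forall i, Fm f i =1 Fm g i.
Hypothesis Fm_id : forall X i, Fm (cmap_id X) i =1 id.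
Hypothesis Fm_comp : forall X Y Z (g : cmap Y Z) (f : cmap X Y) i,
  Fm (cmap_comp g f) i =1 Fm g i \o Fm f i.
Hypothesis Fm_qiso : forall X Y (f : cmap X Y),
  quasi_iso f -> quasi_iso (Fm f).

Fixpoint derived_map X Y (f : dhom X Y) : dhom (F X) (F Y) :=
  match f with
  | dhom_id X => dhom_id (F X)
  | dhom_comp _ _ _ g f => dhom_comp (derived_map g) (derived_map f)
  | dhom_map _ _ f => dhom_map (Fm f)
  | dhom_inv _ _ _ qs => dhom_inv (Fm_qiso qs)
  end.

Lemma derived_map_heq X Y (f g : dhom X Y) :
  deq f g -> deq (derived_map f) (derived_map g).
Proof.
elim=> {X Y f g} /=.
- by move=> *; apply: deq_refl.
- by move=> *; apply: deq_sym.
- by move=> X Y f g h _ fg _ gh; apply: deq_trans fg gh.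
- by move=> *; apply: deq_comp.
- by move=> *; apply: deq_idl.
- by move=> *; apply: deq_idr.
- by move=> *; apply: deq_assoc.
- by move=> X Y f g fg; apply: deq_map; apply: Fm_ext.
- move=> X; apply: deq_trans (deq_map_id _).
  by apply: deq_map => i x; rewrite Fm_id.
- move=> X Y Z g f; apply: deq_trans (deq_map_comp _ _).
  by apply: deq_map => i x; rewrite Fm_comp.
- by move=> *; apply: deq_invl.
- by move=> *; apply: deq_invr.
Qed.

Definition derived_functor : functor D D :=
  @Functor D D F derived_map derived_map_heq (fun X => deq_refl (dhom_id (F X)))
    (fun _ _ _ g f => deq_refl (dhom_comp (derived_map g) (derived_map f))).
End Extension.

End DerivedCategory.

Definition transport (R : pzRingType) (X : int -> lmodType R) (i j : int) :
  {linear X i -> X j} :=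
  match i =P j with
  | ReflectT e => ecast k {linear X i -> X k} e (idfun : {linear X i -> X i})
  | ReflectF _ => \0
  end.

Lemma transport_id (R : pzRingType) (X : int -> lmodType R) i (x : X i) :
  transport X i i x = x.
Proof. by rewrite /transport; case: eqP => // e; rewrite eq_axiomK. Qed.

Lemma transport0 (R : pzRingType) (X : int -> lmodType R) i j (x : X i) :
  i != j -> transport X i j x = 0.
Proof. by rewrite /transport; case: eqP. Qed.

Section Truncations.
Variables (R : pzRingType) (n : int).
Implicit Types X Y : cpx R.

Definition trunc_le_submodule X (i : int) : submodule (X i).
Proof.
exists (fun x => (i = n -> cycle x) /\ (n < i -> x = 0)).
  by rewrite /cycle linear0.
move=> a u v [u1 u2] [v1 v2]; split=> [/[dup] /u1 eu /v1 ev|/[dup] /u2 -> /v2 ->].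
  by rewrite /cycle linearP eu ev scaler0 addr0.
by rewrite scaler0 addr0.
Defined.

Lemma trunc_le_stable X (i j : int) (x : X i) :
  trunc_le_submodule X i x -> trunc_le_submodule X j (diff X i j x).
Proof.
move=> [x1 x2]; split=> [_|nj]; first by rewrite /cycle diffK.
have [ji|ji] := eqVneq j (i + 1); last by rewrite diff_shape.
subst j; have [/x1 //|ni] := eqVneq i n.
by rewrite x2 ?linear0 //; lia.
Qed.

Definition trunc_le X : cpx R.
Proof.
exists (fun i => submodule_lmod (trunc_le_submodule X i))
       (fun i j => restrict (@trunc_le_stable X i j)).
- by move=> i j x ji; apply: val_inj; apply: diff_shape.
- by move=> i j k x; apply: val_inj; apply: diffK.
Defined.

(* The terms of trunc_gt are 0 x 0 in degrees < n, 0 x Im d^n in degree n, and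
   X^i x 0 in degrees i > n, as submodules of X^i x X^(i+1).  The differential
   of (x, y) is (d x + y, 0). *)
Definition trunc_gt_submodule X (i : int) :
  submodule (prod_lmod (X i) (X (i + 1))).
Proof.
exists (fun z => [/\ i <= n -> z.1 = 0,
  i = n -> exists w : X i, diff X i (i + 1) w = z.2 & i != n -> z.2 = 0]).
  by split=> // _; exists 0; rewrite linear0.
move=> a u v [u1 u2 u3] [v1 v2 v3]; split=> [le|e|ne] /=.
- by rewrite u1 ?v1 // scaler0 addr0.
- case: (u2 e) (v2 e) => [w <-] [w' <-]; exists (a *: w + w').
  by rewrite linearP.
- by rewrite u3 ?v3 // scaler0 addr0.
Defined.

Definition trunc_gt_diff0 X (i j : int) :
  {linear prod_lmod (X i) (X (i + 1)) ->
          prod_lmod (X j) (X (j + 1))}.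
Proof.
apply: (@mklin R _ _ (fun z : prod_lmod (X i) (X (i + 1)) =>
  (diff X i j z.1 + transport X (i + 1) j z.2, 0) :
    prod_lmod (X j) (X (j + 1)))).
move=> a [x y] [x' y']; congr pair; rewrite /=; last by rewrite scaler0 addr0.
by rewrite !linearP scalerDr addrACA.
Defined.

Lemma trunc_gt_stable X (i j : int) z :
  trunc_gt_submodule X i z -> trunc_gt_submodule X j (trunc_gt_diff0 X i j z).
Proof.
case: z => x y [/= z1 z2 z3]; split=> //= [jn|_]; last by exists 0; rewrite linear0.
have [ji|ji] := eqVneq j (i + 1); last first.
  by rewrite diff_shape // transport0 ?addr0 // eq_sym.
subst j; rewrite z1 ?z3 ?linear0 ?addr0 //; first by apply/eqP; lia.
by lia.
Qed.

Definition trunc_gt X : cpx R.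
Proof.
exists (fun i => submodule_lmod (trunc_gt_submodule X i))
       (fun i j => restrict (@trunc_gt_stable X i j)).
- move=> i j x ji; apply: val_inj => /=; congr pair.
  by rewrite diff_shape // transport0 ?addr0 // eq_sym.
- move=> i j k x; apply: val_inj => /=; congr pair.
  rewrite linear0 addr0 linearD /= diffK add0r.
  have [ji|ji] := eqVneq j (i + 1); last first.
    by rewrite transport0 ?linear0 // eq_sym.
  subst j; rewrite transport_id.
  case: x => -[x y] /= /asboolP [/= _ y1 y2].
  have [/y1 [w <-]|/y2 ->] := eqVneq i n; first by rewrite diffK.
  by rewrite linear0.
Defined.

Definition trunc_gt_map0 X Y (f : cmap X Y) (i : int) :
  {linear prod_lmod (X i) (X (i + 1)) -> prod_lmod (Y i) (Y (i + 1))}.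
Proof.
apply: (@mklin R _ _ (fun z : prod_lmod (X i) (X (i + 1)) =>
  (f i z.1, f (i + 1) z.2) : prod_lmod (Y i) (Y (i + 1)))).
by move=> a [x y] [x' y']; congr pair; rewrite /= linearP.
Defined.

Lemma trunc_gt_map_stable X Y (f : cmap X Y) i z :
  trunc_gt_submodule X i z -> trunc_gt_submodule Y i (trunc_gt_map0 f i z).
Proof.
case: z => x y [/= z1 z2 z3]; split=> /= [/z1 ->|/z2 [w <-]|/z3 ->].
- by rewrite linear0.
- by exists (f i w); rewrite cmap_diff.
- by rewrite linear0.
Qed.

Lemma cmap_transport X Y (f : cmap X Y) i j (x : X i) :
  f j (transport X i j x) = transport Y i j (f i x).
Proof.
have [<-|ij] := eqVneq i j; first by rewrite !transport_id.
by rewrite !transport0 ?linear0.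
Qed.

Definition trunc_gt_map X Y (f : cmap X Y) : cmap (trunc_gt X) (trunc_gt Y).
Proof.
exists (fun i => restrict (@trunc_gt_map_stable X Y f i)) => i j x.
apply: val_inj; rewrite /= linearD cmap_diff /= cmap_transport.
by rewrite linear0.
Defined.

Lemma trunc_gt_ext X Y (f g : cmap X Y) :
  (forall i, f i =1 g i) -> forall i, trunc_gt_map f i =1 trunc_gt_map g i.
Proof. by move=> fg i x; apply: val_inj; rewrite /= !fg. Qed.

Lemma trunc_gt_map_id X i : trunc_gt_map (cmap_id X) i =1 id.
Proof. by move=> x; apply: val_inj => /=; case: (sval x). Qed.

Lemma trunc_gt_map_comp X Y Z (g : cmap Y Z) (f : cmap X Y) i :
  trunc_gt_map (cmap_comp g f) i =1 trunc_gt_map g i \o trunc_gt_map f i.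
Proof. by move=> x; apply: val_inj. Qed.

Lemma trunc_gt_in X i (x : X i) : n < i -> trunc_gt_submodule X i (x, 0).
Proof. by move=> ni; split=> //=; [lia | exists 0; rewrite linear0]. Qed.

Lemma trunc_gt_im X (w : X n) : trunc_gt_submodule X n (0, diff X n (n + 1) w).
Proof. by split=> //= [_|/eqP //]; exists w. Qed.

Lemma trunc_gt_cycle_le X i (z : trunc_gt X i) : i <= n -> cycle z -> z = 0.
Proof.
move=> le_in /(congr1 val) /= [] ez; apply: val_inj; move: ez.
case: (submodule_typeP z); rewrite /= => z1 _ z3.
have := z1 le_in; case: (val z) z3 => x y /= z3 ->.
by rewrite linear0 add0r transport_id => ->.
Qed.

Lemma trunc_gt_cycle_gt X i (z : trunc_gt X i) : n < i ->
  (val z).2 = 0 /\ (cycle z -> cycle (X := X) (val z).1).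
Proof.
move=> ni; case: (submodule_typeP z) => _ _; rewrite gt_eqF // => /(_ isT) z2.
split=> // /(congr1 val) /= [].
by rewrite [X in transport _ _ _ X]z2 linear0 addr0.
Qed.

Lemma boundary0 X i : boundary (0 : X i).
Proof. by exists i, 0; rewrite linear0. Qed.

Lemma trunc_gt_boundary X i (z : trunc_gt X i) : n < i ->
  boundary z <-> boundary (X := X) (val z).1.
Proof.
move=> ni; have [z2 _] := trunc_gt_cycle_gt z ni; split.
  case=> j [w /(congr1 val) /= <- /=].
  have [ij|ne] := eqVneq i (j + 1); last first.
    by rewrite diff_shape // transport0 ?addr0 1?eq_sym //; exact: boundary0.
  subst i; rewrite transport_id; case: (submodule_typeP w) => w1 w2 w3.
  have [jn|jn] := eqVneq j n.
    case: (w2 jn) => u <-; rewrite w1 ?jn // linear0 add0r.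
    by exists j, u.
  by rewrite w3 // addr0; exists j, (val w).1.
case=> j [w ew].
have zE : val z = ((val z).1, 0) by case: (val z) z2 => ? ? /= ->.
have [ij|ne] := eqVneq i (j + 1); last first.
  have -> : z = 0; last exact: boundary0.
  by apply: val_inj; rewrite zE -ew diff_shape.
subst i; have [jn|jn] := eqVneq j n.
  subst j; exists n, (to_submodule (trunc_gt_im w)).
  by apply: val_inj; rewrite zE /= linear0 add0r transport_id ew.
have nj : n < j by lia.
exists j, (to_submodule (trunc_gt_in w nj)).
by apply: val_inj; rewrite zE /= linear0 addr0 ew.
Qed.

Lemma trunc_gt_qiso X Y (f : cmap X Y) :
  quasi_iso f -> quasi_iso (trunc_gt_map f).
Proof.
move=> qf i; have [le_in|lt_ni] := leP i n.
  split=> [z /(trunc_gt_cycle_le le_in) -> _|z /(trunc_gt_cycle_le le_in) ->].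
    exact: boundary0.
  exists 0; first by rewrite /cycle linear0.
  by rewrite linear0 subr0; exact: boundary0.
have [fi fs] := qf i; split=> [z cz|z cz].
  rewrite !(trunc_gt_boundary _ lt_ni) /=; apply: fi.
  by case: (trunc_gt_cycle_gt z lt_ni) => _; apply.
have [z2 /(_ cz)/fs[x cx bx]] := trunc_gt_cycle_gt z lt_ni.
exists (to_submodule (trunc_gt_in x lt_ni)).
  by apply: val_inj; rewrite /= cx linear0 addr0.
by apply/(trunc_gt_boundary _ lt_ni); rewrite /=.
Qed.

Definition sigma_gt : functor (D R) (D R) :=
  derived_functor trunc_gt_ext trunc_gt_map_id trunc_gt_map_comp trunc_gt_qiso.

End Truncations.

(* Hom^n(X, Y) = prod_p Hom(X^p, Y^(p + n)), as families over all pairs of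
   degrees that vanish off the diagonal q = p + n. *)
Record cochain (R : comPzRingType) (X Y : cpx R) (n : int) := Cochain {
  cochain_fun :> forall p q : int, {linear X p -> Y q};
  cochain_shape : forall (p q : int) (x : X p),
    q != p + n -> cochain_fun p q x = 0 }.

Section Cochains.
Variables (R : comPzRingType) (X Y : cpx R) (n : int).
Notation C := (cochain X Y n).
Implicit Types f g h : C.

Lemma cochain_ext f g : (forall p q x, f p q x = g p q x) -> f = g.
Proof.
case: f g => f Hf [g Hg] /= fg; have efg : f = g.
  apply: functional_extensionality_dep => p.
  apply: functional_extensionality_dep => q.
  exact/linear_ext/fg.
by subst g; rewrite (Prop_irrelevance Hf Hg).
Qed.

HB.instance Definition _ := gen_eqMixin C.
HB.instance Definition _ := gen_choiceMixin C.

Definition cochain_zero : C.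
Proof. by exists (fun p q => \0 : {linear X p -> Y q}). Defined.
Definition cochain_opp f : C.
Proof.
exists (fun p q => (-%R) \o f p q : {linear X p -> Y q}).
by move=> p q x pq /=; rewrite cochain_shape ?oppr0.
Defined.
Definition cochain_add f g : C.
Proof.
exists (fun p q => f p q \+ g p q : {linear X p -> Y q}).
by move=> p q x pq /=; rewrite !cochain_shape ?addr0.
Defined.
Definition cochain_scale (a : R) f : C.
Proof.
exists (fun p q => a \*: f p q : {linear X p -> Y q}).
by move=> p q x pq /=; rewrite cochain_shape ?scaler0.
Defined.

Lemma cochain_addA : associative cochain_add.
Proof. by move=> f g h; apply: cochain_ext => p q x /=; rewrite addrA. Qed.
Lemma cochain_addC : commutative cochain_add.
Proof. by move=> f g; apply: cochain_ext => p q x /=; rewrite addrC. Qed.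
Lemma cochain_add0 : left_id cochain_zero cochain_add.
Proof. by move=> f; apply: cochain_ext => p q x /=; rewrite add0r. Qed.
Lemma cochain_addN : left_inverse cochain_zero cochain_opp cochain_add.
Proof. by move=> f; apply: cochain_ext => p q x /=; rewrite addNr. Qed.
HB.instance Definition _ := GRing.isZmodule.Build C
  cochain_addA cochain_addC cochain_add0 cochain_addN.

Lemma cochain_scaleA a b f :
  cochain_scale a (cochain_scale b f) = cochain_scale (a * b) f.
Proof. by apply: cochain_ext => p q x /=; rewrite scalerA. Qed.
Lemma cochain_scale1 : left_id 1 cochain_scale.
Proof. by move=> f; apply: cochain_ext => p q x /=; rewrite scale1r. Qed.
Lemma cochain_scaleDr : right_distributive cochain_scale +%R.
Proof.
by move=> a f g; apply: cochain_ext => p q x /=; rewrite scalerDr.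
Qed.
Lemma cochain_scaleDl f : {morph cochain_scale^~ f : a b / a + b}.
Proof.
by move=> a b; apply: cochain_ext => p q x /=; rewrite scalerDl.
Qed.
HB.instance Definition _ := GRing.Zmodule_isLmodule.Build R C
  cochain_scaleA cochain_scale1 cochain_scaleDr cochain_scaleDl.
End Cochains.

Definition koszul_sign (R : pzRingType) (n : int) : R := (-1) ^+ `|n|%N.

Lemma cochainDE (R : comPzRingType) (X Y : cpx R) n (f g : cochain X Y n) p q x :
  (f + g) p q x = f p q x + g p q x.
Proof. by []. Qed.

Lemma cochainNE (R : comPzRingType) (X Y : cpx R) n (f : cochain X Y n) p q x :
  (- f) p q x = - f p q x.
Proof. by []. Qed.

Section HomComplex.
Variable R : comPzRingType.
Implicit Types X Y Z : cpx R.

Lemma koszul_signS (n : int) : koszul_sign R (n + 1) = - koszul_sign R n.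
Proof.
rewrite /koszul_sign; case: n => n.
  by rewrite -PoszD addn1 absz_nat exprS mulN1r.
rewrite NegzE abszN absz_nat exprS mulN1r opprK.
by congr (_ ^+ _); lia.
Qed.

Definition cochain_diff X Y (n m : int) (f : cochain X Y n) : cochain X Y m.
Proof.
unshelve refine (@Cochain R X Y m (fun p q => @mklin R (X p) (Y q) (fun x =>
  if m == n + 1 then
    diff Y (q - 1) q (f p (q - 1) x) -
      koszul_sign R n *: f (p + 1) q (diff X p (p + 1) x)
  else 0) _) _).
- move=> a x y; case: (m =P n + 1) => _; last by rewrite scaler0 addr0.
  by rewrite !linearP /= scalerDr addrACA.
- move=> p q x pq /=; case: (m =P n + 1) => // mE; subst m.
  by rewrite !cochain_shape ?linear0 ?addr0 //; apply/eqP; lia.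
Defined.

Lemma cochain_diffE X Y n (f : cochain X Y n) p q x :
  cochain_diff (n + 1) f p q x =
  diff Y (q - 1) q (f p (q - 1) x) - koszul_sign R n *: f (p + 1) q (diff X p (p + 1) x).
Proof. by rewrite /= eqxx. Qed.

Definition Hom_cpx X Y : cpx R.
Proof.
unshelve refine (@Cpx R (fun n => cochain X Y n)
  (fun n m => @mklin R (cochain X Y n) (cochain X Y m) (@cochain_diff X Y n m) _)
  _ _).
- move=> a f g; apply: cochain_ext => p q x /=.
  case: (m =P n + 1) => _ /=.
    rewrite linearP /= [a *: (_ - _)]scalerBr scalerDr !scalerA.
    by rewrite [a * _]mulrC opprD addrACA.
  by rewrite scaler0 addr0.
- by move=> n m f /= /negbTE mn; apply: cochain_ext => p q x /=; rewrite mn.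
- move=> n m k f /=; apply: cochain_ext => p q x /=.
  case: (k =P m + 1) => //= _; case: (m =P n + 1) => [->|_] /=; last first.
    by rewrite linear0 scaler0 subr0.
  rewrite linearB /= !diffK linearZ linear0 scaler0 subr0 sub0r koszul_signS.
  by rewrite scaleNr opprK addrC subrr.
Defined.

Definition Hom_map X Y Z (f : cmap Y Z) : cmap (Hom_cpx X Y) (Hom_cpx X Z).
Proof.
unshelve refine (@Cmap R (Hom_cpx X Y) (Hom_cpx X Z)
  (fun n => @mklin R (cochain X Y n) (cochain X Z n)
    (fun g => @Cochain R X Z n (fun p q => f q \o g p q) _) _) _).
- by move=> p q x pq /=; rewrite cochain_shape ?linear0.
- by move=> a g h; apply: cochain_ext => p q x /=; rewrite linearP.
- move=> n m g; apply: cochain_ext => p q x /=.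
  case: (m =P n + 1) => _ /=.
    by rewrite linearB linearZ /= cmap_diff.
  by rewrite linear0.
Defined.

Lemma Hom_mapE X Y Z (f : cmap Y Z) n (g : cochain X Y n) p q x :
  Hom_map X f n g p q x = f q (g p q x).
Proof. by []. Qed.

Lemma Hom_map_ext X Y Z (f g : cmap Y Z) : (forall i, f i =1 g i) ->
  forall i, Hom_map X f i =1 Hom_map X g i.
Proof. by move=> fg i h; apply: cochain_ext => p q x /=; rewrite fg. Qed.

Lemma Hom_map_id X Y i : Hom_map X (cmap_id Y) i =1 id.
Proof. by move=> h; apply: cochain_ext. Qed.

Lemma Hom_map_comp X Y Z T (g : cmap Z T) (f : cmap Y Z) i :
  Hom_map X (cmap_comp g f) i =1 Hom_map X g i \o Hom_map X f i.
Proof. by move=> h; apply: cochain_ext. Qed.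

Definition K_projective P : Prop :=
  forall A, acyclic A -> acyclic (Hom_cpx P A).

Definition cone Y Z (s : cmap Y Z) : cpx R.
Proof.
unshelve refine (@Cpx R (fun i => prod_lmod (Y (i + 1)) (Z i))
  (fun i j => @mklin R (prod_lmod (Y (i + 1)) (Z i))
     (prod_lmod (Y (j + 1)) (Z j)) (fun u =>
    (- diff Y (i + 1) (j + 1) u.1,
     transport Z (i + 1) j (s (i + 1) u.1) + diff Z i j u.2)) _) _ _).
- move=> a [y z] [y' z']; congr pair; rewrite /= !linearP //.
  by rewrite scalerDr addrACA.
- move=> i j [y z] ij; congr pair; rewrite /=.
    by rewrite diff_shape ?oppr0 //; apply/eqP=> ?; case/eqP: ij; lia.
  by rewrite transport0 ?add0r 1?eq_sym // diff_shape.
- move=> i j k [y z]; congr pair; rewrite /=.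
    by rewrite linearN /= diffK !oppr0.
  rewrite linearD /= diffK addr0.
  have [ij|ij] := eqVneq j (i + 1); last first.
    rewrite [transport Z _ j _]transport0 1?eq_sym // linear0 addr0.
    rewrite diff_shape ?oppr0 ?linear0 //; apply/eqP=> ?; case/eqP: ij; lia.
  subst j; rewrite transport_id; have [jk|jk] := eqVneq k (i + 1 + 1).
    by subst k; rewrite transport_id linearN cmap_diff addNr.
  by rewrite transport0 1?eq_sym // add0r diff_shape.
Defined.

Lemma boundaryP X i (x : X (i + 1)) : boundary x ->
  exists y : X i, diff X i (i + 1) y = x.
Proof.
move=> [j [y <-]]; have [/addIr ij|ij] := eqVneq (i + 1) (j + 1).
  by subst j; exists y.
by exists 0; rewrite linear0 diff_shape.
Qed.

Lemma cone_acyclic Y Z (s : cmap Y Z) : quasi_iso s -> acyclic (cone s).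
Proof.
move=> qs i; have [k ->] : exists k, i = k + 1 by exists (i - 1); lia.
move=> [y z] [/= dy]; rewrite transport_id => dz.
have {}dy : cycle y by apply/eqP; rewrite -oppr_eq0; apply/eqP.
have [y' ey] : exists y', diff Y (k + 1) (k + 1 + 1) y' = y.
  apply/boundaryP/((qs _).1 _ dy); exists (k + 1), (- z).
  by rewrite linearN; apply/esym/eqP; rewrite -addr_eq0; apply/eqP.
have /((qs _).2 _)[x cx /boundaryP[w ew]] : cycle (z + s (k + 1) y').
  by rewrite /cycle linearD -cmap_diff ey [LHS]addrC.
exists k, (x - y', w); congr pair => /=.
  by rewrite linearB cx sub0r opprK.
by rewrite transport_id ew linearB /= [LHS]addrC subrKA addrK.
Qed.

Section ConeCochains.
Variables (P Y Z : cpx R) (s : cmap Y Z).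

Lemma intS (q : int) : exists r, q = r + 1.
Proof. by exists (q - 1); lia. Qed.

Lemma cochain_diffSE X X' n (f : cochain X X' n) p q x :
  cochain_diff (n + 1) f p (q + 1) x =
  diff X' q (q + 1) (f p q x)
  - koszul_sign R n *: f (p + 1) (q + 1) (diff X p (p + 1) x).
Proof. by rewrite cochain_diffE (_ : q + 1 - 1 = q) //; lia. Qed.

Definition cone_fst n (F : cochain P (cone s) n) : cochain P Y (n + 1).
Proof.
unshelve refine (@Cochain R P Y (n + 1) (fun p q => @mklin R (P p) (Y q)
  (fun x => transport Y (q - 1 + 1) q (F p (q - 1) x).1) _) _).
- by move=> a x y; rewrite !linearP.
- by move=> p q x pq /=; rewrite cochain_shape ?linear0 //; apply/eqP; lia.
Defined.

Lemma cone_fstE n (F : cochain P (cone s) n) p q x :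
  cone_fst F p (q + 1) x = (F p q x).1.
Proof. by rewrite /= (_ : q + 1 - 1 = q) ?transport_id //; lia. Qed.

Definition cone_snd n (F : cochain P (cone s) n) : cochain P Z n.
Proof.
unshelve refine (@Cochain R P Z n (fun p q => @mklin R (P p) (Z q)
  (fun x => (F p q x).2) _) _).
- by move=> a x y; rewrite !linearP.
- by move=> p q x pq /=; rewrite cochain_shape.
Defined.

Lemma cone_sndE n (F : cochain P (cone s) n) p q x :
  cone_snd F p q x = (F p q x).2.
Proof. by []. Qed.

Definition cone_pair n (f : cochain P Y (n + 1)) (g : cochain P Z n) :
  cochain P (cone s) n.
Proof.
unshelve refine (@Cochain R P (cone s) n (fun p q => @mklin R (P p) (cone s q)
  (fun x => (f p (q + 1) x, g p q x)) _) _).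
- by move=> a x y; congr pair; rewrite !linearP.
- move=> p q x pq /=; congr pair; rewrite cochain_shape //; apply/eqP; lia.
Defined.

Lemma cone_fst_pair n f g : cone_fst (@cone_pair n f g) = f.
Proof.
by apply: cochain_ext => p q x; have [r ->] := intS q; rewrite cone_fstE.
Qed.

Lemma cone_snd_pair n f g : cone_snd (@cone_pair n f g) = g.
Proof. exact: cochain_ext. Qed.

Lemma cone_cochain_ext n (F G : cochain P (cone s) n) :
  cone_fst F = cone_fst G -> cone_snd F = cone_snd G -> F = G.
Proof.
move=> e1 e2; apply: cochain_ext => p q x.
have f1 : (F p q x).1 = (G p q x).1 by rewrite -!cone_fstE e1.
have f2 : (F p q x).2 = (G p q x).2.
  exact: (congr1 (fun h : cochain P Z n => h p q x) e2).
by case: (F p q x) (G p q x) f1 f2 => ? ? [? ?] /= -> ->.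
Qed.

Lemma cone_fst_diff n (F : cochain P (cone s) n) :
  cone_fst (cochain_diff (n + 1) F) = - cochain_diff (n + 1 + 1) (cone_fst F).
Proof.
apply: cochain_ext => p q x; have [q' ->] := intS q; have [r ->] := intS q'.
rewrite cone_fstE cochainNE !cochain_diffSE !cone_fstE.
by rewrite koszul_signS scaleNr opprK opprD.
Qed.

Lemma cone_snd_diff n (F : cochain P (cone s) n) :
  cone_snd (cochain_diff (n + 1) F) =
  Hom_map P s (n + 1) (cone_fst F) + cochain_diff (n + 1) (cone_snd F).
Proof.
apply: cochain_ext => p q x; have [r ->] := intS q.
rewrite cochainDE !cochain_diffSE Hom_mapE !cone_fstE cone_sndE.
rewrite cochain_diffSE.
by rewrite /= transport_id addrA.
Qed.
End ConeCochains.

Lemma Hom_qiso P (Pproj : K_projective P) Y Z (s : cmap Y Z) :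
  quasi_iso s -> quasi_iso (Hom_map P s).
Proof.
move=> qs n; have Cac := Pproj _ (cone_acyclic qs).
have [k ->] := intS n; have [l lE] := intS k; subst k; split=> [f cf|g cg].
  case/boundaryP => g eg.
  pose F := @cone_pair P Y Z s (l + 1) f (- g).
  have cF : cycle (X := Hom_cpx P (cone s)) F.
    apply: cone_cochain_ext; rewrite ?cone_fst_diff ?cone_snd_diff.
      rewrite cone_fst_pair [cochain_diff _ _]cf oppr0.
      by apply/esym/cochain_ext => p q x; rewrite /= linear0.
    rewrite cone_fst_pair cone_snd_pair.
    rewrite [cochain_diff _ _](linearN (diff (Hom_cpx P Z) (l + 1) _)) eg subrr.
    exact: cochain_ext.
  have /boundaryP[H eH] := Cac _ _ cF.
  exists (l + 1), (- cone_fst H : Hom_cpx P Y (l + 1)).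
  have := congr1 (@cone_fst _ _ _ _ _) eH.
  by rewrite cone_fst_diff cone_fst_pair linearN.
pose F := @cone_pair P Y Z s (l + 1 + 1) 0 g.
have cF : cycle (X := Hom_cpx P (cone s)) F.
  apply: cone_cochain_ext; rewrite ?cone_fst_diff ?cone_snd_diff.
    rewrite cone_fst_pair [cochain_diff _ _](linear0 (diff (Hom_cpx P Y) _ _)).
    by rewrite oppr0; apply/esym/cochain_ext => p q x; rewrite /= linear0.
  rewrite cone_fst_pair cone_snd_pair (linear0 (Hom_map P s _)) add0r.
  by rewrite [cochain_diff _ _]cg; exact: cochain_ext.
have /boundaryP[H eH] := Cac _ _ cF.
exists (cone_fst H).
  have := congr1 (@cone_fst _ _ _ _ _) eH.
  rewrite cone_fst_diff cone_fst_pair => /eqP; rewrite oppr_eq0 => /eqP.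
  exact.
exists (l + 1), (cone_snd H).
have := congr1 (@cone_snd _ _ _ _ _) eH.
rewrite cone_snd_diff cone_snd_pair => <-.
by rewrite [RHS]addrAC subrr add0r.
Qed.

Record K_projective_resolution X := KProjectiveResolution {
  kp_obj :> cpx R;
  kp_map : cmap kp_obj X;
  kp_projective : K_projective kp_obj;
  kp_qiso : quasi_iso kp_map }.

(* RHom_R(X, -) = Hom_R(P, -) for a K-projective resolution P of X. *)
Definition RHom X (P : K_projective_resolution X) : functor (D R) (D R) :=
  derived_functor (@Hom_map_ext P) (@Hom_map_id P) (@Hom_map_comp P)
    (Hom_qiso (@kp_projective X P)).

End HomComplex.

Section Supports.
Variable R : comPzRingType.

Lemma tensor_map_pi (M M' N : lmodType R) (f : {linear M -> M'}) s :
  tensor_map N f (pm_pi (M := tensor_premodule M N) s) =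
  pm_pi (M := tensor_premodule M' N) (tensor_mapl f s).
Proof. exact/pm_piP/(tensor_maplE f)/(pm_reprP (M := tensor_premodule M N)). Qed.

Lemma tensor_mapl0 (M M' N : lmodType R) (f : M -> M') (s : seq (M * N)) :
  (forall m, f m = 0) ->
  pm_pi (M := tensor_premodule M' N) (tensor_mapl f s) = 0.
Proof.
move=> f0; apply/pm_piP; elim: s => [|[m n] s IH] /=; first exact: tensor_refl.
by rewrite f0; apply: (@tensor_cat _ _ _ [:: _] [::] _ [::]) => //; constructor.
Qed.

(* X (x) N for a module N placed in degree 0. *)
Definition tensor_cpx (X : cpx R) (N : lmodType R) : cpx R.
Proof.
exists (fun i => tensor (X i) N) (fun i j => tensor_map N (diff X i j)).
- move=> i j; elim/pm_quotW => s ij; rewrite [LHS]tensor_map_pi.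
  by apply: tensor_mapl0 => m; exact: diff_shape.
- move=> i j k; elim/pm_quotW => s.
  rewrite (tensor_map_pi (diff X i j)) tensor_map_pi.
  rewrite /tensor_mapl -map_comp.
  by apply: (@tensor_mapl0 _ _ _ (diff X j k \o diff X i j)) => m; exact: diffK.
Defined.

(* X (x)^L kappa(p) is computed with a K-projective (hence K-flat) resolution
   of X; the choice of resolution does not matter.  An object of D(R) is zero
   if and only if it is acyclic. *)
Definition supp (X : cpx R) (p : Spec R) : Prop :=
  exists P : K_projective_resolution X,
    ~ acyclic (tensor_cpx P (residue_field p)).

Definition specialization_closed (W : Spec R -> Prop) : Prop :=
  forall p q : Spec R, W p -> (forall x, p x -> q x) -> W q.

Definition smashing (L : D R -> Prop) : Prop :=
  exists W : Spec R -> Prop, specialization_closed W /\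
    forall X, L X <-> (forall p, supp X p -> W p).

End Supports.

(* Main.v *)
From HB Require Import structures.
Require Import Defs.
From mathcomp Require Import all_boot all_order all_algebra.
From mathcomp Require Import boolp classical_sets.
From mathcomp Require Import zify ring.
(* Restores Defs' [cycle] and [intS], shadowed by path and ssrint. *)
Import Defs.

Set Implicit Arguments.
Unset Strict Implicit.
Unset Printing Implicit Defensive.

Import Order.TTheory GRing.Theory Num.Theory.
Local Open Scope ring_scope.

(* Let W be the specialization-closed set defining L.  Membership of Z in L
   means that H(Z) vanishes locally at every prime outside W.  Let G =
   Gamma_W(I) be the subcomplex of torsion elements; each G^i is a direct
   summand of I^i because an essential extension of a torsion module is
   torsion.  A cochain h : K -> I with torsion coboundary can be made
   torsion-valued degree by degree, starting from the lowest degree of I, as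
   long as the homology of K in the degrees met is torsion: modulo torsion,
   h then kills cycles, hence extends along the differential of K.  For K a
   resolution of an object of L this shows that G -> I has the universal
   property of the counit, and for K = P, whose homology is torsion in
   negative degrees, that Hom(P, G) -> Hom(P, I) is an isomorphism on
   cohomology in degrees > n.  In the critical degree n + 1, injectivity
   also uses the splitting of G^n in I^n. *)

(** * Free modules *)

(** Small support is tested on residue fields, whereas the correction of cochains needs every cycle
    to become a boundary after multiplication by a scalar outside p. For unbounded complexes no
    induction on degrees links the two. In one direction, Noetherian induction on an ideal a shows
    that a cycle modulo a is, up to such a scalar, a boundary modulo a; the case a = 0 is the goal.
    This consumes the residue fields at all q contained in p, and none of these q lies in W when p
    does not, because W is specialization-closed. In the other direction, K-projectivity makes P ->
    P_p null-homotopic. The retractions of the I^i onto their torsion are chosen degree by degree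
    and need not commute with the differential, so they do not retract I onto G; hence the
    corrections by coboundaries. Since D(R) is a formal localization, its morphisms are accessible
    only through K-projective resolutions, over which they become chain maps and their equalities
    become homotopies. *)

Section FreeModule.
Variables (R : pzRingType) (S : choiceType).

Definition lincomb (N : lmodType R) (f : S -> N) (s : seq (R * S)) : N :=
  \sum_(x <- s) x.1 *: f x.2.

Lemma lincomb_cat (N : lmodType R) (f : S -> N) s t :
  lincomb f (s ++ t) = lincomb f s + lincomb f t.
Proof. exact: big_cat. Qed.

Lemma lincomb_scale (N : lmodType R) (f : S -> N) a s :
  lincomb f [seq (a * x.1, x.2) | x <- s] = a *: lincomb f s.
Proof.
rewrite /lincomb big_map scaler_sumr.
by apply: eq_bigr => x _; rewrite scalerA.
Qed.

(* Two formal combinations are identified when every map from S to a module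
   gives them the same value, so that the universal property is immediate. *)
Definition free_rel (s t : seq (R * S)) : Prop :=
  forall (N : lmodType R) (f : S -> N), lincomb f s = lincomb f t.

Definition free_premodule : premodule R.
Proof.
apply: (@Premodule R (seq (R * S) : choiceType) free_rel [::]
  (fun s => [seq (-1 * x.1, x.2) | x <- s]) cat
  (fun a s => [seq (a * x.1, x.2) | x <- s])) => //.
- by move=> s t st N f.
- by move=> s t u st tu N f; rewrite st.
- by move=> s t st N f; rewrite !lincomb_scale st.
- by move=> s s' t t' ss tt N f; rewrite !lincomb_cat ss tt.
- by move=> a s t st N f; rewrite !lincomb_scale st.
- by move=> s t u N f; rewrite !lincomb_cat addrA.
- by move=> s t N f; rewrite !lincomb_cat addrC.
- move=> s N f.
  by rewrite lincomb_cat lincomb_scale scaleN1r addNr [RHS]big_nil.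
- by move=> a b s N f; rewrite !lincomb_scale scalerA.
- by move=> s N f; rewrite lincomb_scale scale1r.
- by move=> a s t N f; rewrite lincomb_cat !lincomb_scale lincomb_cat scalerDr.
- by move=> a b s N f; rewrite lincomb_cat !lincomb_scale scalerDl.
Defined.

Definition freemod : lmodType R := pm_lmod free_premodule.

Definition fgen (x : S) : freemod :=
  pm_pi (M := free_premodule) [:: (1 : R, x)].

Lemma free_lift_spec (N : lmodType R) (f : S -> N) :
  {h : {linear freemod -> N} |
    forall s, h (pm_pi (M := free_premodule) s) = lincomb f s}.
Proof.
have E s : lincomb f (repr (pm_pi (M := free_premodule) s)) = lincomb f s.
  exact: (pm_reprP (M := free_premodule) s).
have lin : linear (fun u : pm_quot free_premodule => lincomb f (repr u)).
  move=> a; elim/pm_quotW => s; elim/pm_quotW => t.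
  rewrite [a *: pm_pi s]pmq_scaleE [_ + pm_pi t]pmq_addE !E.
  by rewrite [LHS]lincomb_cat lincomb_scale.
by exists (@mklin R freemod N _ lin) => s; exact: E.
Qed.

Definition free_lift (N : lmodType R) (f : S -> N) : {linear freemod -> N} :=
  sval (free_lift_spec f).

Lemma free_lift_pi (N : lmodType R) (f : S -> N) s :
  free_lift f (pm_pi (M := free_premodule) s) = lincomb f s.
Proof. exact: (svalP (free_lift_spec f)). Qed.

Lemma free_lift_gen (N : lmodType R) (f : S -> N) x :
  free_lift f (fgen x) = f x.
Proof. by rewrite free_lift_pi /lincomb big_seq1 scale1r. Qed.

Lemma free_pi s : pm_pi (M := free_premodule) s = lincomb fgen s.
Proof.
elim: s => [|[a x] s IH]; first by rewrite /lincomb big_nil.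
rewrite /lincomb big_cons -/(lincomb _ _) -IH /=.
rewrite [a *: _]pmq_scaleE [RHS]pmq_addE /=.
by apply/pm_piP => N f; rewrite /lincomb /= !big_cons mulr1.
Qed.

Lemma freemodP (u : freemod) : exists s, u = lincomb fgen s.
Proof.
by elim/(@pm_quotW R free_premodule): u => s; exists s; rewrite free_pi.
Qed.

Lemma linear_lincomb (N N' : lmodType R) (h : {linear N -> N'}) (f : S -> N) s :
  h (lincomb f s) = lincomb (h \o f) s.
Proof. by rewrite linear_sum; apply: eq_bigr => x _; rewrite linearZ. Qed.

Lemma free_ext (N : lmodType R) (f g : {linear freemod -> N}) :
  (forall x, f (fgen x) = g (fgen x)) -> f =1 g.
Proof.
move=> fg u; have [s ->] := freemodP u; rewrite !linear_lincomb.
by apply: eq_bigr => x _; rewrite /= fg.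
Qed.

End FreeModule.

(* Projectivity, in the form given by the dual basis lemma. *)
Definition dual_basis (R : pzRingType) (M : lmodType R) : Prop :=
  exists (K : Type) (e : K -> M) (c : K -> {linear M -> R^o}),
    forall x, exists s : seq K, x = \sum_(k <- s) (c k x : R) *: e k.

Lemma free_dual_basis (R : pzRingType) (S : choiceType) :
  dual_basis (freemod R S).
Proof.
pose c (k : S) := free_lift (fun x => (x == k)%:R : R^o).
exists S, (@fgen R S), c => u; have [s ->] := freemodP u.
(* Each generator is listed once, since its coordinate already collects all its occurrences in
   [s]. *)
exists (undup [seq x.2 | x <- s]).
rewrite {1}/lincomb.
transitivity (\sum_(x <- s) \sum_(k <- undup [seq x.2 | x <- s])
   (x.1 * (x.2 == k)%:R) *: fgen R k).
  apply: eq_big_seq => x xs.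
  rewrite (bigD1_seq x.2) ?undup_uniq //=; last first.
    by rewrite mem_undup map_f.
  rewrite eqxx mulr1 big1 ?addr0 // => k kx.
  by rewrite eq_sym (negbTE kx) mulr0 scale0r.
rewrite exchange_big; apply: eq_bigr => k _.
have -> : c k (lincomb (@fgen R S) s) = \sum_(x <- s) x.1 * (x.2 == k)%:R.
  rewrite (linear_lincomb (c k)).
  by apply: eq_bigr => x _; congr (_ * _); apply: free_lift_gen.
by rewrite scaler_suml.
Qed.

(** * Semifree resolutions *)

Section SemifreeResolution.
Variables (R : comPzRingType) (Z : cpx R).

(* A cell [Cell s y] is a generator attached along the chain [s], to be mapped
   to [y]; it is given a nonzero boundary only when [s] is a cycle whose image
   is the boundary of [y]. *)
Inductive cell : int -> Type :=
  Cell (n : int) : seq (R * cell (n + 1)) -> Z n -> cell n.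

HB.instance Definition _ (n : int) := gen_eqMixin (cell n).
HB.instance Definition _ (n : int) := gen_choiceMixin (cell n).

Definition chain (n : int) : lmodType R := freemod R (cell n).

Definition zsum (V : lmodType R) (s : seq (R * V)) : V :=
  \sum_(x <- s) x.1 *: x.2.

Definition attached (n : int) (y : Z n) (b : chain (n + 1 + 1))
    (v : Z (n + 1)) : Prop :=
  b = 0 /\ v = diff Z n (n + 1) y.

(** The pair of boundary and image in [Z]. The sums are spelled out over [s] because [chain_diff]
    and [chain_map] are themselves defined from this recursion; [cell_dataE] restores them.
    Ill-attached cells get (0, 0) and are harmless. *)
Fixpoint cell_data (n : int) (c : cell n) : chain (n + 1) * Z n :=
  match c in cell n return chain (n + 1) * Z n with
  | Cell n s y =>
    if `[< attached y (zsum [seq (x.1, (cell_data x.2).1) | x <- s])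
                      (zsum [seq (x.1, (cell_data x.2).2) | x <- s]) >]
    then (lincomb (@fgen R (cell (n + 1))) s, y) else (0, 0)
  end.

Definition chain_diff (n : int) : {linear chain n -> chain (n + 1)} :=
  free_lift (fun c : cell n => (cell_data c).1).

Definition chain_map (n : int) : {linear chain n -> Z n} :=
  free_lift (fun c : cell n => (cell_data c).2).

Lemma cell_dataE (n : int) s (y : Z n) :
  let z := lincomb (@fgen R (cell (n + 1))) s in
  cell_data (Cell s y) =
  if `[< attached y (chain_diff _ z) (chain_map _ z) >] then (z, y) else (0, 0).
Proof.
have E (V : lmodType R) (f : cell (n + 1) -> V) :
    zsum [seq (x.1, f x.2) | x <- s] = free_lift f (lincomb (@fgen R _) s).
  rewrite linear_lincomb /zsum big_map; apply: eq_bigr => x _ /=.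
  by rewrite free_lift_gen.
by rewrite /= (E _ (fun c => (cell_data c).1)) (E _ (fun c => (cell_data c).2)).
Qed.

Lemma cell_data1 (n : int) s (y : Z n) :
  let b : chain (n + 1) := (cell_data (Cell s y)).1 in
  b = lincomb (@fgen R (cell (n + 1))) s \/ b = 0.
Proof.
move=> b; rewrite {}/b cell_dataE.
case: asboolP => _; [left | right]; reflexivity.
Qed.

Lemma cell_data_attached (n : int) (c : cell n) :
  chain_diff _ (cell_data c).1 = 0 /\
  chain_map _ (cell_data c).1 = diff Z n (n + 1) (cell_data c).2.
Proof.
case: c => {}n s y; rewrite cell_dataE.
by case: asboolP => [[]|_] //=; rewrite !linear0.
Qed.

Lemma chain_diffK (n : int) u : chain_diff (n + 1) (chain_diff n u) = 0.
Proof.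
pose z : {linear chain n -> chain (n + 1 + 1)} := \0.
rewrite -[RHS]/(z u) -[LHS]/((chain_diff (n + 1) \o chain_diff n) u).
apply: free_ext => c /=; rewrite free_lift_gen.
exact: (cell_data_attached c).1.
Qed.

Lemma chain_map_diff (n : int) u :
  chain_map (n + 1) (chain_diff n u) = diff Z n (n + 1) (chain_map n u).
Proof.
rewrite -[LHS]/((chain_map (n + 1) \o chain_diff n) u).
rewrite -[RHS]/((diff Z n (n + 1) \o chain_map n) u).
apply: free_ext => c /=; rewrite !free_lift_gen.
exact: (cell_data_attached c).2.
Qed.

Definition semifree : cpx R.
Proof.
exists chain (fun i j => transport chain (i + 1) j \o chain_diff i).
- by move=> i j x ij /=; rewrite transport0 // eq_sym.
- move=> i j k x /=; have [ij|ij] := eqVneq (i + 1) j; last first.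
    by rewrite [X in chain_diff _ X]transport0 ?linear0.
  by subst j; rewrite transport_id chain_diffK linear0.
Defined.

Lemma semifree_diffE (n : int) (u : semifree n) :
  diff semifree n (n + 1) u = chain_diff n u.
Proof. exact: transport_id. Qed.

Definition semifree_map : cmap semifree Z.
Proof.
exists chain_map => i j x /=.
have [<-|ij] := eqVneq (i + 1) j; last first.
  by rewrite transport0 // linear0 diff_shape // eq_sym.
by rewrite transport_id chain_map_diff.
Defined.

(** A cell exists for every possible attaching datum, so one inductive type replaces the usual
    sequence of stages. An arbitrary [z] gives injectivity on homology, and [z = 0] gives
    surjectivity. *)
Lemma attach_cell (n : int) (z : chain (n + 1)) (y : Z n) :
  chain_diff _ z = 0 -> chain_map _ z = diff Z n (n + 1) y ->
  exists c : chain n, chain_diff _ c = z /\ chain_map _ c = y.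
Proof.
have [s ->] := freemodP z => dz mz; exists (fgen R (Cell s y)).
rewrite !free_lift_gen cell_dataE; case: asboolP => [_ //|]; by case.
Qed.

Lemma semifree_qiso : quasi_iso semifree_map.
Proof.
move=> i; have [n ->] := intS i; split=> [z cz /boundaryP[y yz]|y cy].
  have [||c [<- _]] := @attach_cell n z y => //.
    by rewrite -semifree_diffE.
  by exists n, c; rewrite semifree_diffE.
have [||c [dc mc]] := @attach_cell (n + 1) 0 y; rewrite ?linear0 //.
exists c; first by apply: etrans (semifree_diffE c) dc.
by rewrite /= mc subrr; apply: boundary0.
Qed.

(** Induction that reaches the cells nested inside the sequence of a cell, for which a hypothesis is
    needed. *)
Lemma cell_ind_mem (P : forall n : int, cell n -> Prop) :
  (forall (n : int) (s : seq (R * cell (n + 1))) (y : Z n),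
     (forall x, x \in s -> P _ x.2) -> P n (Cell s y)) ->
  forall n c, P n c.
Proof.
move=> H; fix IH 2 => n [{}n s y]; apply: H.
elim: s => [|x s IHs] x'; first by rewrite in_nil; discriminate.
have Px : P _ x.2 := IH _ x.2.
rewrite in_cons => /orP[/eqP->|xs]; [exact: Px | exact: IHs _ xs].
Qed.

(** * Cocycles with values in an acyclic complex are coboundaries *)

Section Contraction.
Variables (A : cpx R) (acA : acyclic A) (m : int).
Variable g : cochain semifree A (m + 1).
Hypothesis cg : cycle (X := Hom_cpx semifree A) g.

Definition primitive (p q : int) (v : A q) : A p :=
  match pselect (exists w : A p, diff A p q w = v) with
  | left e => sval (cid e)
  | right _ => 0
  end.

Lemma primitiveP (p q : int) (v : A q) : q = p + 1 -> cycle v ->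
  diff A p q (primitive p v) = v.
Proof.
move=> pq /acA bv; rewrite /primitive; case: pselect => [e|[]].
  by case: cid.
by subst q; apply: boundaryP bv.
Qed.

(** The test asks whether the boundary of the cell really is the chain [s]; otherwise that boundary
    is 0 and contributes nothing. *)
Fixpoint contract (n : int) (c : cell n) : A (n + m) :=
  match c in cell n return A (n + m) with
  | Cell n s y =>
    primitive (n + m) (g n (n + 1 + m) (fgen R (Cell s y)) + koszul_sign R m *:
      (if `[< (cell_data (Cell s y)).1 = lincomb (@fgen R (cell (n + 1))) s >]
       then zsum [seq (x.1, contract x.2) | x <- s] else 0))
  end.

Definition contraction (n : int) : {linear chain n -> A (n + m)} :=
  free_lift (@contract n).

Lemma contractE (n : int) (c : cell n) :
  contract c = primitive (n + m) (g n (n + 1 + m) (fgen R c) +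
    koszul_sign R m *: contraction (n + 1) (cell_data c).1).
Proof.
case: c => {}n s y; rewrite [LHS]/=; congr (primitive _ (_ + _ *: _)).
case: asboolP => [->|].
  rewrite linear_lincomb /zsum big_map; apply: eq_bigr => x _ /=.
  by rewrite /contraction free_lift_gen.
move=> ne; by case: (cell_data1 s y) => // ->; rewrite linear0.
Qed.

Lemma contraction_gen (n : int) (c : cell n) :
  diff A (n + m) (n + 1 + m) (contraction n (fgen R c)) =
  g n (n + 1 + m) (fgen R c)
  + koszul_sign R m *: contraction (n + 1) (chain_diff n (fgen R c)).
Proof.
elim/cell_ind_mem: c => {}n s y IH.
rewrite /chain_diff !free_lift_gen contractE; set c := Cell s y.
have {}IH :
    diff A (n + 1 + m) (n + 1 + 1 + m) (contraction (n + 1) (cell_data c).1) =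
    g (n + 1) (n + 1 + 1 + m) (cell_data c).1.
  pose eqn u := diff A (n + 1 + m) (n + 1 + 1 + m) (contraction (n + 1) u) =
    g (n + 1) (n + 1 + 1 + m) u
      + koszul_sign R m *: contraction (n + 1 + 1) (chain_diff (n + 1) u).
  have : eqn (cell_data c).1.
    case: (cell_data1 s y) => ->; last by rewrite /eqn !linear0 addr0.
    rewrite /eqn !linear_lincomb /lincomb -big_split.
    by apply: eq_big_seq => x /IH ex; rewrite -[RHS]scalerDr -ex.
  rewrite /eqn (cell_data_attached c).1 (linear0 (contraction _)).
  by rewrite scaler0 addr0.
(* It remains to see that the element to be lifted is a cycle. By [IH] its differential is d(g c)
   plus the signed g(dc), which is the cocycle condition on [g], as the sign of degree m + 1 is
   opposite to that of m. *)
apply: primitiveP; first by lia.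
rewrite /cycle (_ : n + 1 + m + 1 = n + 1 + 1 + m); last by lia.
rewrite linearD linearZ IH.
have := congr1 (fun f : cochain semifree A _ =>
  f n (n + 1 + 1 + m) (fgen R c)) cg.
rewrite cochain_diffE (_ : n + 1 + 1 + m - 1 = n + 1 + m); last by lia.
rewrite koszul_signS scaleNr opprK semifree_diffE.
by rewrite /chain_diff free_lift_gen.
Qed.

Lemma contractionE (n : int) u :
  diff A (n + m) (n + 1 + m) (contraction n u) =
  g n (n + 1 + m) u + koszul_sign R m *: contraction (n + 1) (chain_diff n u).
Proof.
have [s ->] := freemodP u; rewrite !linear_lincomb /lincomb -big_split.
by apply: eq_bigr => x _; rewrite -[RHS]scalerDr -contraction_gen.
Qed.

Definition contraction_cochain : cochain semifree A m.
Proof.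
exists (fun p q : int =>
  transport A (p + m) q \o contraction p : {linear semifree p -> A q}).
by move=> p q x pq /=; rewrite transport0 // eq_sym.
Defined.

Lemma contraction_diff : cochain_diff (m + 1) contraction_cochain = g.
Proof.
apply: cochain_ext => p q x.
have [qE|ne] := eqVneq q (p + (m + 1)); last by rewrite !cochain_shape.
have {}qE : q = p + 1 + m by lia.
subst q; rewrite cochain_diffE /= (_ : p + 1 + m - 1 = p + m); last by lia.
by rewrite !transport_id contractionE addrK.
Qed.
End Contraction.

Lemma semifree_K_projective : K_projective semifree.
Proof.
move=> A acA k g cg; have [m mE] := intS k; subst k.
by exists m, (contraction_cochain g); apply: contraction_diff.
Qed.

Definition semifree_resolution : K_projective_resolution Z :=
  KProjectiveResolution semifree_K_projective semifree_qiso.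
End SemifreeResolution.

(** * Morphisms of the derived category *)

Section Boundaries.
Variables (R : comPzRingType) (X Y : cpx R).

Lemma boundaryD i (x y : X i) : boundary x -> boundary y -> boundary (x + y).
Proof.
have [k kE] := intS i; subst i => /boundaryP[u <-] /boundaryP[v <-].
by exists k, (u + v); rewrite linearD.
Qed.

Lemma boundaryZ i a (x : X i) : boundary x -> boundary (a *: x).
Proof. by case=> j [u <-]; exists j, (a *: u); rewrite linearZ. Qed.

Lemma boundaryN i (x : X i) : boundary x -> boundary (- x).
Proof. by rewrite -scaleN1r; apply: boundaryZ. Qed.

Lemma boundary_cmap (f : cmap X Y) i (x : X i) : boundary x -> boundary (f i x).
Proof. by case=> j [u <-]; exists j, (f j u); rewrite cmap_diff. Qed.

Lemma cycle_cmap (f : cmap X Y) i (x : X i) : cycle x -> cycle (f i x).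
Proof. by rewrite /cycle -cmap_diff => ->; rewrite linear0. Qed.

Lemma boundary_cycle i (x : X i) : boundary x -> cycle x.
Proof. by case=> j [u <-]; apply: diffK. Qed.

Lemma cycleB i (x y : X i) : cycle x -> cycle y -> cycle (x - y).
Proof. by rewrite /cycle linearB => -> ->; rewrite subrr. Qed.

Lemma boundary_sym i (x y : X i) : boundary (x - y) -> boundary (y - x).
Proof. by move=> /boundaryN; rewrite opprB. Qed.

Lemma boundary_trans i (y x z : X i) :
  boundary (x - y) -> boundary (y - z) -> boundary (x - z).
Proof. by move=> /boundaryD/[apply]; rewrite subrKA. Qed.

Lemma boundary_subrr i (x : X i) : boundary (x - x).
Proof. by rewrite subrr; apply: boundary0. Qed.

End Boundaries.

Section HomologyRelation.
Variable R : comPzRingType.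

(* The action of a morphism of D(R) on homology, as a relation on cycles. *)
Fixpoint hrel (X Y : cpx R) (f : dhom X Y) (i : int) : X i -> Y i -> Prop :=
  match f in dhom X Y return X i -> Y i -> Prop with
  | dhom_id X => fun x y => boundary (y - x)
  | dhom_comp _ _ _ g f =>
      fun x y => exists z, [/\ cycle z, hrel f x z & hrel g z y]
  | dhom_map _ _ f => fun x y => boundary (y - f i x)
  | dhom_inv _ _ s _ => fun x y => boundary (x - s i y)
  end.

Lemma hrel_shift (X Y : cpx R) (f : dhom X Y) i (x x' : X i) (y y' : Y i) :
  boundary (x - x') -> boundary (y - y') -> hrel f x y -> hrel f x' y'.
Proof.
elim: f x x' y y' => {X Y} [X|X Y Z g IHg f IHf|X Y f|X Y s qs]
  x x' y y' bx yy /=.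
- move=> yx; apply: boundary_trans bx.
  by apply: boundary_trans yx; apply: boundary_sym.
- case=> z [cz xz zy]; exists z; split=> //.
    by apply: IHf xz => //; apply: boundary_subrr.
  by apply: IHg zy => //; apply: boundary_subrr.
- move=> yx; apply: (boundary_trans (y := f i x)).
    by apply: boundary_trans yx; apply: boundary_sym.
  by rewrite -linearB; apply: boundary_cmap.
- move=> yx; apply: (boundary_trans (y := s i y)).
    by apply: boundary_trans yx; apply: boundary_sym.
  by rewrite -linearB; apply: boundary_cmap.
Qed.

(** Equality in D(R) is a generated congruence and cannot be inverted directly; this invariant is
    how consequences are drawn from it. Cycles are assumed because an inverted map acts well only on
    homology. *)
Lemma hrel_deq (X Y : cpx R) (f g : dhom X Y) : deq f g ->
  forall i (x : X i) (y : Y i), cycle x -> cycle y -> hrel f x y <-> hrel g x y.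
Proof.
elim=> {X Y f g} [X Y f|X Y f g _ IH|X Y f g h _ IH1 _ IH2
  |X Y Z g g' f f' _ IHg _ IHf|X Y f|X Y f|X Y Z T h g f|X Y f g fg|X|X Y Z g f
  |X Y s qs|X Y s qs] i x y cx cy /=.
- by [].
- by rewrite IH.
- by rewrite IH1 // IH2.
- by split=> -[z [cz xz zy]]; exists z; split=> //; apply/IHf || apply/IHg.
- split=> [[z [cz xz zy]]|xy].
    by apply: hrel_shift xz; [exact: boundary_subrr | exact: boundary_sym].
  by exists y; split=> //; apply: boundary_subrr.
- split=> [[z [cz xz zy]]|xy].
    by apply: hrel_shift zy => //; apply: boundary_subrr.
  by exists x; split=> //; apply: boundary_subrr.
- split=> [[z [cz [t [ct xt tz]] zy]]|[t [ct xt [z [cz tz zy]]]]].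
    by exists t; split=> //; exists z.
  by exists z; split=> //; exists t.
- by rewrite fg.
- by [].
- split=> [yx|[z [cz bz yz]]].
    exists (f i x); split=> //; first exact: cycle_cmap.
    exact: boundary_subrr.
  by apply: (boundary_trans yz); rewrite -linearB; apply: boundary_cmap.
- split=> [[z [cz bz yz]]|yx]; last first.
    exists (s i x); split; [exact: cycle_cmap | exact: boundary_subrr |].
    by rewrite -linearB; apply/boundary_cmap/boundary_sym.
  apply: (qs i).1; first exact: cycleB.
  rewrite linearB; apply: boundary_trans bz; exact: boundary_sym.
- split=> [[z [cz bz yz]]|yx].
    by apply: (boundary_trans yz); apply: boundary_sym.
  have [z cz bz] := (qs i).2 _ cx.
  by exists z; split=> //; apply: boundary_trans bz.
Qed.
End HomologyRelation.

(** * Homotopies and morphisms out of K-projective complexes *)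

Section Homotopy.
Variable R : comPzRingType.
Implicit Types X Y Z : cpx R.

Definition cmap_cochain X Y (f : cmap X Y) : cochain X Y 0.
Proof.
exists (fun p q : int => transport Y p q \o f p : {linear X p -> Y q}).
by move=> p q x; rewrite addr0 => pq /=; rewrite transport0 // eq_sym.
Defined.

Lemma cmap_cochainE X Y (f : cmap X Y) p x : cmap_cochain f p p x = f p x.
Proof. exact: transport_id. Qed.

Lemma cmap_cochain_comp X Y Z (g : cmap Y Z) (f : cmap X Y) :
  Hom_map X g 0 (cmap_cochain f) = cmap_cochain (cmap_comp g f).
Proof. by apply: cochain_ext => p q x; rewrite /= cmap_transport. Qed.

Lemma koszul_sign0 : koszul_sign R 0 = 1. Proof. by []. Qed.

Lemma cmap_cochain_cycle X Y (f : cmap X Y) :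
  cycle (X := Hom_cpx X Y) (cmap_cochain f).
Proof.
apply: cochain_ext => p q x; have [qE|ne] := eqVneq q (p + (0 + 1)); last first.
  by rewrite [LHS]cochain_shape.
rewrite (cochain_diffE (cmap_cochain f)) koszul_sign0 scale1r.
rewrite (_ : q - 1 = p); last by lia.
rewrite (_ : q = p + 1); last by lia.
by rewrite !cmap_cochainE cmap_diff subrr.
Qed.

Lemma cocycle_cmap X Y (c : cochain X Y 0) : cycle (X := Hom_cpx X Y) c ->
  exists f : cmap X Y, cmap_cochain f = c.
Proof.
move=> cc; unshelve eexists (@Cmap R X Y (fun i => c i i) _) => [i j x|].
  have [->|ne] := eqVneq j (i + 1); last by rewrite !diff_shape ?linear0.
  have := congr1 (fun h : cochain X Y _ => h i (i + 1) x) cc.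
  rewrite cochain_diffE koszul_sign0 scale1r (_ : i + 1 - 1 = i); last by lia.
  by move/eqP; rewrite subr_eq0 => /eqP.
apply: cochain_ext => p q x /=; have [<-|ne] := eqVneq p q.
  exact: transport_id.
by rewrite transport0 // cochain_shape // addr0 eq_sym.
Qed.

Definition homotopic X Y (f g : cmap X Y) : Prop :=
  boundary (X := Hom_cpx X Y) (cmap_cochain f - cmap_cochain g).

Definition cone_in X : cmap X (cone (cmap_id X)).
Proof.
unshelve refine (@Cmap R X (cone (cmap_id X)) (fun i =>
  @mklin R (X i) (prod_lmod (X (i + 1)) (X i)) (fun x => (0, x)) _) _).
  by move=> a x y; congr pair; rewrite /= scaler0 addr0.
by move=> i j x; congr pair; rewrite /= !linear0 ?oppr0 ?add0r.
Defined.

Definition dsum X Y : cpx R.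
Proof.
unshelve refine (@Cpx R (fun i => prod_lmod (X i) (Y i)) (fun i j =>
  @mklin R (prod_lmod (X i) (Y i)) (prod_lmod (X j) (Y j))
    (fun u => (diff X i j u.1, diff Y i j u.2)) _) _ _).
- by move=> a [x y] [x' y']; congr pair; rewrite linearP.
- by move=> i j x ij; congr pair; rewrite /= diff_shape.
- by move=> i j k x; congr pair; rewrite /= diffK.
Defined.

Definition dsum_pair X Y Z (f : cmap Z X) (g : cmap Z Y) : cmap Z (dsum X Y).
Proof.
unshelve refine (@Cmap R Z (dsum X Y) (fun i =>
  @mklin R (Z i) (prod_lmod (X i) (Y i)) (fun z => (f i z, g i z)) _) _).
- by move=> a x y; congr pair; rewrite linearP.
- by move=> i j x; congr pair; rewrite /= cmap_diff.
Defined.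

Definition cmap0 X Y : cmap X Y.
Proof.
exists (fun i => \0 : {linear X i -> Y i}).
by move=> i j x /=; rewrite linear0.
Defined.

Definition dsum_fst X Y : cmap (dsum X Y) X.
Proof.
unshelve refine (@Cmap R (dsum X Y) X (fun i =>
  @mklin R (prod_lmod (X i) (Y i)) (X i) fst _) _).
- by [].
- by [].
Defined.

Lemma dsum_fst_qiso X Y : acyclic Y -> quasi_iso (dsum_fst X Y).
Proof.
move=> acY i; split=> [[x y] cxy /= bx|x cx].
  have /= cy := congr1 snd cxy.
  have [k kE] := intS i; subst i.
  have /boundaryP[x' <-] := bx; have /boundaryP[y' <-] := acY _ _ cy.
  by exists k, (x', y').
exists (x, 0); last by rewrite /= subrr; apply: boundary0.
by congr pair; rewrite ?linear0.
Qed.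

Lemma cmap_id_qiso X : quasi_iso (cmap_id X).
Proof.
move=> i; split=> // x cx; exists x => //=.
exact: boundary_subrr.
Qed.

Lemma homotopicP X Y (f g : cmap X Y) : homotopic f g ->
  exists h : forall i : int, {linear X (i + 1) -> Y i},
    forall i (x : X (i + 1)), diff Y i (i + 1) (h i x) +
      h (i + 1) (diff X (i + 1) (i + 1 + 1) x) = f (i + 1) x - g (i + 1) x.
Proof.
(* Degree 0 is written [-1 + 1], the successor form that [boundaryP] expects. *)
move=> fg; have : boundary (X := Hom_cpx X Y) (i := -1 + 1)
  (cmap_cochain f - cmap_cochain g) by [].
case/boundaryP => c cE; exists (fun i => c (i + 1) i) => i x.
have := congr1 (fun b : cochain X Y (-1 + 1) => b (i + 1) (i + 1) x) cE.
rewrite cochainDE cochainNE !cmap_cochainE => <-.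
rewrite (cochain_diffE c) (_ : i + 1 - 1 = i); last by lia.
by rewrite (_ : koszul_sign R (-1) = -1) // scaleN1r opprK.
Qed.

(* Both [g] and [f] factor through X + cone(id): as the composites of one map
   with the two sections (id, 0) and (id, x |-> (0, x)) of the projection to X,
   which is a quasi-isomorphism. *)
Lemma homotopic_deq X Y (f g : cmap X Y) : homotopic f g ->
  deq (dhom_map f) (dhom_map g).
Proof.
move=> /homotopicP[h hE]; pose C := cone (cmap_id X).
have lin i : linear (fun u : prod_lmod (X i) (prod_lmod (X (i + 1)) (X i)) =>
    g i u.1 + (h i u.2.1 + (f i u.2.2 - g i u.2.2))).
  move=> a [x [y z]] [x' [y' z']] /=; rewrite !linearP /=.
  rewrite !scalerDr [RHS]addrACA; congr (_ + _); rewrite [RHS]addrACA.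
  by congr (_ + _); apply: addrACA.
unshelve epose (H := (@Cmap R (dsum X C) Y (fun i => mklin (lin i)) _)).
  move=> i j [x [y z]] /=; have [->|ne] := eqVneq j (i + 1); last first.
    rewrite !linearD !linearN /= -!cmap_diff !(diff_shape _ ne) !linear0.
    rewrite transport0 1?eq_sym // !linear0.
    rewrite diff_shape ?linear0 ?oppr0 ?addr0 //.
    by apply/eqP=> e; case/eqP: ne; lia.
  rewrite transport_id !linearD !linearN /= !cmap_diff.
  have := hE i y; set u := h _ (diff _ _ _ _) => /eqP.
  rewrite -subr_eq => /eqP <-; rewrite !addrA; congr (_ + _).
  rewrite opprK (addrAC _ _ (diff Y _ _ (f i z))) addrK.
  by rewrite (addrAC _ (- u)) subrK.
have H1 : deq (dhom_map f) (dhom_comp (dhom_map H)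
    (dhom_map (dsum_pair (cmap_id X) (cone_in X)))).
  apply: deq_trans (deq_map_comp _ _); apply: deq_map => i x /=.
  by rewrite linear0 add0r addrC subrK.
have H0 : deq (dhom_map g) (dhom_comp (dhom_map H)
    (dhom_map (dsum_pair (cmap_id X) (cmap0 X C)))).
  apply: deq_trans (deq_map_comp _ _); apply: deq_map => i x /=.
  by rewrite !linear0 !addr0.
apply: deq_trans H1 (deq_trans _ (deq_sym H0)); apply: deq_comp (deq_refl _) _.
have qs := dsum_fst_qiso X (cone_acyclic (@cmap_id_qiso X)).
have E k : deq (dhom_map (dsum_pair (cmap_id X) k)) (dhom_inv qs).
  apply: deq_trans (deq_sym (deq_idl _)) _.
  apply: deq_trans (deq_comp (deq_sym (deq_invl qs)) (deq_refl _)) _.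
  apply: deq_trans (deq_sym (deq_assoc _ _ _)) _.
  apply: deq_trans (deq_idr _); apply: deq_comp (deq_refl _) _.
  apply: deq_trans (deq_sym (deq_map_comp _ _)) (deq_trans _ (deq_map_id _)).
  exact: deq_map.
exact: deq_trans (E _) (deq_sym (E _)).
Qed.

Lemma K_projective_lift Q X Y (s : cmap X Y) (a : cmap Q Y) :
  K_projective Q -> quasi_iso s ->
  exists b : cmap Q X, deq (dhom_map (cmap_comp s b)) (dhom_map a).
Proof.
move=> Qproj qs.
have [c cc bc] := (Hom_qiso Qproj qs 0).2 _ (cmap_cochain_cycle a).
have [b bE] := cocycle_cmap cc; exists b; apply/homotopic_deq/boundary_sym.
by rewrite -cmap_cochain_comp bE.
Qed.

(** Induction on the formal composite; only an inverted quasi-isomorphism requires work, and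
    [K_projective_lift] moves the chain map across it. *)
Lemma dhom_K_projective Q X Y (f : dhom X Y) (a : cmap Q X) : K_projective Q ->
  exists b : cmap Q Y, deq (dhom_comp f (dhom_map a)) (dhom_map b).
Proof.
move=> Qproj; elim: f a => {X Y} [X|X Y Z g IHg f IHf|X Y f|X Y s qs] a.
- by exists a; apply: deq_idl.
- have [b fb] := IHf a; have [c gc] := IHg b; exists c.
  apply: deq_trans (deq_sym (deq_assoc _ _ _)) _.
  by apply: deq_trans gc; apply: deq_comp (deq_refl _) fb.
- by exists (cmap_comp f a); apply/deq_sym/deq_map_comp.
- have [b sb] := K_projective_lift a Qproj qs; exists b.
  apply: deq_trans (deq_comp (deq_refl _) (deq_sym sb)) _.
  apply: deq_trans (deq_comp (deq_refl _) (deq_map_comp _ _)) _.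
  apply: deq_trans (deq_assoc _ _ _) _.
  by apply: deq_trans (deq_comp (deq_invl qs) (deq_refl _)) (deq_idl _).
Qed.

(** The functor Hom(Q, -) respects quasi-isomorphisms, hence is defined on D(R). Its values on [a]
    and [b] send the class of the identity of Q to the classes of [a] and [b], so these coincide in
    H^0. *)
Lemma deq_homotopic Q Y (a b : cmap Q Y) : K_projective Q ->
  deq (dhom_map a) (dhom_map b) -> homotopic a b.
Proof.
move=> Qproj ab; pose x := cmap_cochain (cmap_id Q).
have E f : Hom_map Q f 0 x = cmap_cochain f.
  by rewrite cmap_cochain_comp; apply: cochain_ext.
have Hab := derived_map_heq (@Hom_map_ext R Q) (@Hom_map_id R Q)
  (@Hom_map_comp R Q) (Hom_qiso Qproj) ab.
have Ha : hrel (derived_map (Hom_qiso Qproj) (dhom_map a)) x (cmap_cochain a).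
  rewrite -E; exact: boundary_subrr.
rewrite /homotopic -(E _ b).
have cQ := cmap_cochain_cycle (cmap_id Q).
exact: (hrel_deq Hab cQ (cmap_cochain_cycle a)).1 Ha.
Qed.
End Homotopy.

Section Isomorphisms.
Variable C : category.
Implicit Types a b c : C.

Lemma isomorphism_heq a b (f g : hom a b) :
  heq f g -> isomorphism f -> isomorphism g.
Proof.
move=> fg [h [hf fh]]; exists h; split.
  by apply: heq_trans (compose_heq (heq_refl _) (heq_sym fg)) hf.
by apply: heq_trans (compose_heq (heq_sym fg) (heq_refl _)) fh.
Qed.

Lemma isomorphism_compose a b c (g : hom b c) (f : hom a b) :
  isomorphism g -> isomorphism f -> isomorphism (compose g f).
Proof.
have cancel a' b' c' (u : hom b' c') (u' : hom c' b') (v : hom a' b')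
    (v' : hom b' a') : heq (compose u' u) (idm b') ->
    heq (compose v' v) (idm a') ->
    heq (compose (compose v' u') (compose u v)) (idm a').
  move=> uu vv; apply: heq_trans (heq_sym (composeA _ _ _)) _.
  apply: heq_trans (compose_heq (heq_refl _) (composeA _ _ _)) _.
  apply: heq_trans (compose_heq (heq_refl _) (compose_heq uu (heq_refl _))) _.
  by apply: heq_trans (compose_heq (heq_refl _) (compose_idl _)) vv.
move=> [g' [gl gr]] [f' [fl fr]]; exists (compose f' g').
by split; apply: cancel.
Qed.

Lemma isomorphism_fmap (C' : category) (F : functor C C') a b (f : hom a b) :
  isomorphism f -> isomorphism (fmap F f).
Proof.
have fcomp (u : hom a b) (v : hom b a) : heq (compose u v) (idm b) ->
    heq (compose (fmap F u) (fmap F v)) (idm (F b)).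
  move=> uv; apply: heq_trans (heq_sym (fmap_comp F u v)) _.
  exact: heq_trans (fmap_heq F uv) (fmap_id F b).
move=> [g [gf fg]]; exists (fmap F g); split; last exact: fcomp.
apply: heq_trans (heq_sym (fmap_comp F g f)) _.
exact: heq_trans (fmap_heq F gf) (fmap_id F a).
Qed.
End Isomorphisms.

Lemma quasi_iso_isomorphism (R : pzRingType) (X Y : cpx R) (s : cmap X Y) :
  quasi_iso s -> isomorphism (C := D R) (dhom_map s).
Proof.
by move=> qs; exists (dhom_inv qs); split; [apply: deq_invl | apply: deq_invr].
Qed.

(** * Torsion submodules of injective modules *)

Section NoetherianInduction.
Variables (R : comPzRingType) (noethR : noetherian R).

Lemma submoduleZ (M : lmodType R) (N : submodule M) (a : R) (x : M) :
  N x -> N (a *: x).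
Proof.
move=> Nx; rewrite -[_ *: _]addr0.
by apply: submoduleP => //; apply: submodule0.
Qed.

Lemma submoduleD (M : lmodType R) (N : submodule M) (x y : M) :
  N x -> N y -> N (x + y).
Proof. by move=> Nx Ny; rewrite -[x]scale1r; apply: submoduleP. Qed.

Lemma submoduleB (M : lmodType R) (N : submodule M) (x y : M) :
  N x -> N y -> N (x - y).
Proof.
by move=> Nx Ny; rewrite -scaleN1r addrC; apply: submoduleP.
Qed.

Lemma submodule_sum (M : lmodType R) (N : submodule M) (I : Type) (s : seq I)
    (F : I -> M) : (forall i, N (F i)) -> N (\sum_(i <- s) F i).
Proof.
move=> NF; apply: big_ind => //; [exact: submodule0 | exact: submoduleD].
Qed.

Lemma idealMl (a : ideal R) (r s : R) : a r -> a (s * r).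
Proof. exact: (submoduleZ (M := R^o)). Qed.

Lemma idealMr (a : ideal R) (r s : R) : a r -> a (r * s).
Proof. by rewrite mulrC; apply: idealMl. Qed.

Definition ideal_lt (a b : ideal R) : Prop :=
  (forall x, a x -> b x) /\ exists x, b x /\ ~ a x.

Lemma noetherian_ind (P : ideal R -> Prop) :
  (forall a, (forall b, ideal_lt a b -> P b) -> P a) -> forall a, P a.
Proof.
move=> IH a0; apply: contrapT => nPa0.
pose bad := {a : ideal R | ~ P a}.
have /choice[next nextP] : forall a : bad, exists b : bad,
    ideal_lt (sval a) (sval b).
  move=> [a nPa] /=; apply: contrapT => nb; apply: nPa; apply: IH => b ab.
  by apply: contrapT => nPb; apply: nb; exists (exist _ b nPb).
pose A n := sval (iter n next (exist _ a0 nPa0)).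
have Amono m n x : (m <= n)%N -> A m x -> A n x.
  move=> /subnK <-; elim: (n - m)%N => // k IHk /IHk.
  exact: (nextP _).1.
have U : {U : ideal R | forall x, U x <-> exists n, A n x}.
  unshelve eexists (@Submodule R R^o (fun x => exists n, A n x) _ _) => //.
    by exists 0%N; apply: submodule0.
  move=> c u v [m um] [n vn]; exists (maxn m n); apply: submoduleP.
    by apply: Amono um; apply: leq_maxl.
  by apply: Amono vn; apply: leq_maxr.
case: U => U UE; have [s sE] := noethR U.
have [N AN] : exists N, forall i, (i < size s)%N -> A N s`_i.
  have As i : (i < size s)%N -> exists n, A n s`_i.
    move=> si; apply/UE/sE; exists (fun j => (j == i)%:R).
    rewrite (bigD1 (Ordinal si)) //= eqxx mul1r big1 ?addr0 // => j.
    by rewrite -val_eqE /= => /negbTE ->; rewrite mul0r.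
  elim: (size s) As => [|k IHk] As; first by exists 0%N.
  have [i ik|N AN] := IHk; first by apply: As; apply: ltnW.
  have [n An] := As k (ltnSn k); exists (maxn N n) => i.
  rewrite ltnS leq_eqVlt => /orP[/eqP->|/AN AN'].
    by apply: Amono An; apply: leq_maxr.
  by apply: Amono AN'; apply: leq_maxl.
have [_ [x [xN nxN]]] := nextP (iter N next (exist _ a0 nPa0)).
apply: nxN; have /sE[c ->] : U x by apply/UE; exists N.+1.
apply: (big_ind (A N)) => [||i _]; first exact: submodule0.
  exact: submoduleD.
exact/(submoduleZ (M := R^o))/AN.
Qed.

Definition colon (M : lmodType R) (N : submodule M) (x : M) : ideal R.
Proof.
exists (fun r => N (r *: x)); first by rewrite scale0r; apply: submodule0.
by move=> a u v Nu Nv; rewrite scalerDl -scalerA; apply: submoduleP.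
Defined.

Lemma prime_or_zero_divisor (a : ideal R) : ~ a 1 ->
  (exists q : Spec R, forall x, q x <-> a x) \/
  exists s t : R, [/\ a (s * t), ~ a s & ~ a t].
Proof.
move=> a1.
have [st|nst] := pselect (exists s t : R, [/\ a (s * t), ~ a s & ~ a t]).
  by right.
left; unshelve eexists (@PrimeIdeal R a a1 _) => // x y axy.
apply: contrapT => /not_orP[nx ny]; apply: nst.
by exists x, y.
Qed.

(** An associated prime of M / N inside p, found among the annihilators of multiples of [x]. An
    annihilator that is not prime is enlarged by passing to a multiple of [x], with care to keep it
    inside p. *)
Lemma prime_colon (M : lmodType R) (N : submodule M) (p : Spec R) (x : M) :
  (forall r, N (r *: x) -> p r) ->
  exists (s : R) (q : Spec R), (forall r : R, q r <-> N (r *: (s *: x))) /\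
    forall r, q r -> p r.
Proof.
move: {2}(colon N x) (erefl (colon N x)) => a.
elim/noetherian_ind: a x => a IH x.
move=> aE xp; subst a; have [|[q qE]|[s [t [/= st ns nt]]]] :=
    @prime_or_zero_divisor (colon N x).
- by rewrite /= => /xp; apply: prime_proper.
- exists 1, q; split=> r; rewrite ?scale1r; first exact: qE.
  by move=> /qE/xp.
have rec u : (forall r, N (r *: (u *: x)) -> p r) ->
    (exists r, N (r *: (u *: x)) /\ ~ N (r *: x)) ->
    exists (s : R) (q : Spec R), (forall r : R, q r <-> N (r *: (s *: x))) /\
      forall r, q r -> p r.
  move=> up ux.
  have [||v [q [qE qp]]] := IH (colon N (u *: x)) _ (u *: x) erefl.
  - split=> //= r Nr; rewrite scalerA mulrC -scalerA; exact: submoduleZ.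
  - by [].
  by exists (v * u), q; split=> // r; rewrite qE !scalerA mulrA.
have [sp|/existsNP[u /not_implyP[us npu]]] :=
    pselect (forall r, N (r *: (s *: x)) -> p r).
  apply: (rec s) => //; exists t; split; last exact: nt.
  by rewrite scalerA mulrC; exact: st.
(* Passing to [s *: x] would leave p, as witnessed by [u] outside p. Then [u *: x] serves: its
   annihilator stays in p because p is prime, and it gains [s]. *)
apply: (rec u) => [r|]; last by exists s; rewrite scalerA mulrC -scalerA.
by rewrite scalerA => /xp /prime_mul[].
Qed.
End NoetherianInduction.

Section Torsion.
Variables (R : comPzRingType) (W : Spec R -> Prop).

(* Gamma_W(M): an element is in it when it vanishes at every prime outside W. *)
Definition torsion (M : lmodType R) : submodule M.
Proof.
exists (fun x => forall p : Spec R, ~ W p -> exists2 r : R, ~ p r & r *: x = 0).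
  by move=> p _; exists 1; rewrite ?scaler0 //; apply: (@prime_proper _ p).
move=> a u v tu tv p Wp; have [r pr ru] := tu p Wp; have [s ps sv] := tv p Wp.
exists (r * s); first by move/prime_mul => [].
rewrite scalerDr -[_ *: v]scalerA sv scaler0 addr0 [r * s]mulrC scalerA.
by rewrite mulrAC -!scalerA ru !scaler0.
Defined.

Lemma torsion_linear (M N : lmodType R) (f : {linear M -> N}) x :
  torsion M x -> torsion N (f x).
Proof.
by move=> tx p /tx[r pr rx]; exists r; rewrite // -linearZ rx linear0.
Qed.

Hypothesis noethR : noetherian R.
Hypothesis closedW : specialization_closed W.

(** Zorn's lemma. The second clause says that the image of G in M / C is essential. *)
Lemma maximal_complement (M : lmodType R) (G : submodule M) :
  exists C : submodule M, (forall x, G x -> C x -> x = 0) /\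
    forall y, ~ C y -> exists r c, [/\ C c, G (r *: y + c) & r *: y + c <> 0].
Proof.
pose T := {C : submodule M | forall x, G x -> C x -> x = 0}.
pose le (C C' : T) := `[< forall x, sval C x -> sval C' x >].
have zero : T.
  unshelve eexists (@Submodule R M (fun x => x = 0) _ _) => //.
  by move=> a u v -> ->; rewrite scaler0 addr0.
have [|||C Cmax] := @ZL_preorder T zero le.
- by move=> C; apply/asboolP.
- move=> C1 C2 C3 /asboolP C12 /asboolP C23; apply/asboolP => x.
  by move=> /C12/C23.
- move=> A Atot.
  (* The disjunct [x = 0] provides the zero element when the chain is empty. *)
  unshelve eexists (exist _ (@Submodule R M
    (fun x => x = 0 \/ exists2 C, A C & sval C x) _ _) _) => /=.
  + by left.
  + move=> a u v [->|[C1 A1 u1]] [->|[C2 A2 v2]].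
    * by left; rewrite scaler0 addr0.
    * by right; exists C2; rewrite // scaler0 add0r.
    * by right; exists C1; rewrite // addr0; apply: submoduleZ.
    right; have [/asboolP C12|/asboolP C21] := Atot _ _ A1 A2.
      by exists C2 => //; apply: submoduleP => //; apply: C12.
    by exists C1 => //; apply: submoduleP => //; apply: C21.
  + by move=> x Gx [//|[C _]]; apply: (svalP C).
  + by move=> C AC; apply/asboolP => x Cx /=; right; exists C.
exists (sval C); split=> [|y nCy]; first exact: (svalP C).
apply: contrapT => H; apply: nCy.
have D0 : exists D : submodule M,
    forall x, D x <-> exists r c, sval C c /\ x = r *: y + c.
  unshelve eexists (@Submodule R M (fun x => exists r c,
    sval C c /\ x = r *: y + c) _ _) => //.
    by exists 0, 0; rewrite scale0r addr0; split=> //; apply: submodule0.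
  move=> a _ _ [r [c [Cc ->]]] [r' [c' [Cc' ->]]].
  exists (a * r + r'), (a *: c + c'); split; first exact: submoduleP.
  by rewrite scalerDr scalerA scalerDl addrACA.
case: D0 => D DE; have DG x : G x -> D x -> x = 0.
  move=> Gx /DE[r [c [Cc xE]]]; apply: contrapT => x0; apply: H.
  by exists r, c; rewrite -xE.
have /asboolP/= DC : le (exist _ D DG) C.
  apply: Cmax; apply/asboolP => x Cx /=; apply/DE; exists 0, x.
  by rewrite scale0r add0r.
apply/DC/DE; exists 1, 0; rewrite scale1r addr0.
by split=> //; apply: submodule0.
Qed.

(* With C maximal such that C meets the torsion T trivially, M / C is an
   essential extension of T, hence torsion; so any extension to M of the map
   T + C -> M that kills C and is the identity on T takes torsion values. *)
Lemma torsion_retraction (M : lmodType R) : injective_module M ->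
  exists psi : {linear M -> M}, (forall x, torsion M (psi x)) /\
    forall x, torsion M x -> psi x = x.
Proof.
move=> injM; have [C [CT Cmax]] := maximal_complement (torsion M).
pose S := prod_lmod (submodule_lmod (torsion M)) (submodule_lmod C).
have linj : linear (fun u : S => val u.1 + val u.2).
  by move=> a [x y] [x' y'] /=; rewrite scalerDr addrACA.
have linf : linear (fun u : S => val u.1) by [].
have [|psi psiE] := injM S M (mklin linj) (mklin linf).
  move=> [x y] [x' y'] /= e.
  have tE : val x - val x' = val y' - val y.
    by apply/eqP; rewrite subr_eq addrAC -subr_eq opprK e addrC.
  have x0 : val x - val x' = 0.
    apply: CT; first by apply: submoduleB; apply: submodule_typeP.
    by rewrite tE; apply: submoduleB; apply: submodule_typeP.
  move: (x0); rewrite tE => /eqP; rewrite subr_eq0 => /eqP/val_inj ->.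
  by move: x0 => /eqP; rewrite subr_eq0 => /eqP/val_inj ->.
have psiT x (Tx : torsion M x) : psi x = x.
  by have /= := psiE (to_submodule Tx, 0); rewrite addr0.
have psiC x (Cx : C x) : psi x = 0.
  by have /= := psiE (0, to_submodule Cx); rewrite add0r.
exists psi; split=> // x p Wp.
suff [r pr Crx] : exists2 r : R, ~ p r & C (r *: x).
  by exists r; rewrite // -linearZ psiC.
(* Otherwise some [s *: x] has a prime annihilator q in M / C with q inside p, so q is outside W.
   Essentiality gives a nonzero torsion element [r *: (s *: x) + c] with [r] outside q; some [t]
   outside q kills it, which forces [t * r] into q. *)
apply: contrapT => nr.
have [r Crx|s [q [qE qp]]] := @prime_colon R noethR M C p x.
  by apply: contrapT => npr; apply: nr; exists r.
have nWq : ~ W q by move=> /closedW/(_ qp).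
have [|r [c [Cc Tc nz]]] := Cmax (s *: x).
  by rewrite -[s *: x]scale1r -qE; apply: prime_proper.
have nqr : ~ q r.
  by move=> /qE Cr; apply: nz; apply: CT => //; apply: submoduleD.
have [t nqt tc] := Tc q nWq.
suff : q (t * r) by case/prime_mul.
apply/qE; rewrite -scalerA.
have -> : t *: (r *: (s *: x)) = - (t *: c).
  by apply/eqP; rewrite -addr_eq0 -scalerDr tc.
by rewrite -scalerN -scaleN1r; do 2 apply: submoduleZ.
Qed.
End Torsion.

(** * Local vanishing and residue fields *)

Section TensorPure.
Variable R : comPzRingType.
Implicit Types M N T : lmodType R.

Definition pure M N (m : M) (n : N) : tensor M N :=
  pm_pi (M := tensor_premodule M N) [:: (m, n)].

Lemma tensor_pi M N (s : seq (M * N)) :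
  pm_pi (M := tensor_premodule M N) s = \sum_(x <- s) pure x.1 x.2.
Proof.
elim: s => [|[m n] s IH]; first by rewrite big_nil.
by rewrite big_cons -IH /= [RHS]pmq_addE.
Qed.

Lemma tensorP M N (u : tensor M N) : exists s, u = \sum_(x <- s) pure x.1 x.2.
Proof.
elim/(@pm_quotW R (tensor_premodule M N)): u => s.
by exists s; rewrite tensor_pi.
Qed.

Lemma tensor_ext M N T (f g : {linear tensor M N -> T}) :
  (forall m n, f (pure m n) = g (pure m n)) -> f =1 g.
Proof.
move=> fg u; have [s ->] := tensorP u; rewrite !linear_sum.
by apply: eq_bigr => x _; apply: fg.
Qed.

Lemma pureDl M N (m m' : M) (n : N) : pure (m + m') n = pure m n + pure m' n.
Proof. rewrite [RHS]pmq_addE; exact/pm_piP/tensor_addl. Qed.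

Lemma pureDr M N (m : M) (n n' : N) : pure m (n + n') = pure m n + pure m n'.
Proof. rewrite [RHS]pmq_addE; exact/pm_piP/tensor_addr. Qed.

Lemma pureZl M N a (m : M) (n : N) : pure (a *: m) n = a *: pure m n.
Proof. by rewrite [RHS]pmq_scaleE. Qed.

Lemma pureZr M N a (m : M) (n : N) : pure m (a *: n) = a *: pure m n.
Proof. rewrite -pureZl; exact/pm_piP/tensor_sym/tensor_scale. Qed.

Lemma pure0l M N (n : N) : pure (0 : M) n = 0.
Proof. by rewrite -(scale0r (0 : M)) pureZl scale0r. Qed.

Lemma pure_suml M N (I : Type) (s : seq I) (F : I -> M) (n : N) :
  pure (\sum_(i <- s) F i) n = \sum_(i <- s) pure (F i) n.
Proof.
elim: s => [|i s IH]; first by rewrite !big_nil pure0l.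
by rewrite !big_cons pureDl IH.
Qed.

Lemma tensor_map_pure M M' N (f : {linear M -> M'}) m (n : N) :
  tensor_map N f (pure m n) = pure (f m) n.
Proof. exact: tensor_map_pi. Qed.

Lemma tensor_lift M N T (b : M -> N -> T) :
  (forall m m' n, b (m + m') n = b m n + b m' n) ->
  (forall m n n', b m (n + n') = b m n + b m n') ->
  (forall a m n, b (a *: m) n = a *: b m n) ->
  (forall a m n, b m (a *: n) = a *: b m n) ->
  exists h : {linear tensor M N -> T}, forall m n, h (pure m n) = b m n.
Proof.
move=> bDl bDr bZl bZr.
pose ev (s : seq (M * N)) : T := \sum_(x <- s) b x.1 x.2.
have evE s t : tensor_rel s t -> ev s = ev t.
  rewrite /ev; elim=> {s t} [s|s t _ ->|s t u _ -> _ ->|s s' t t' _ e _ e'|s t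
    |m m' n|m n n'|a m n|n]; rewrite ?big_cat ?big_cons ?big_nil ?addr0 //=.
  - by rewrite e e'.
  - exact: addrC.
  - by rewrite bZl bZr.
  - by rewrite -(scale0r (0 : M)) bZl scale0r.
have evr s : ev (repr (pm_pi (M := tensor_premodule M N) s)) = ev s.
  exact/evE/(pm_reprP (M := tensor_premodule M N)).
have lin : linear (fun u : pm_quot (tensor_premodule M N) => ev (repr u)).
  move=> a; elim/pm_quotW => s; elim/pm_quotW => t.
  rewrite [a *: pm_pi s]pmq_scaleE [_ + pm_pi t]pmq_addE !evr /ev big_cat.
  congr (_ + _); rewrite big_map scaler_sumr; apply: eq_bigr => x _ /=.
  exact: bZl.
exists (@mklin R (tensor M N) T _ lin) => m n /=.
by rewrite evr /ev big_seq1.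
Qed.
End TensorPure.

Section ResidueFieldTheory.
Variables (R : comPzRingType) (p : Spec R).

Definition frac (a : R) (s : outside p) : residue_field p :=
  pm_pi (M := residue_premodule p) (a, s).

Lemma fracP (k : residue_field p) : exists a s, k = frac a s.
Proof.
by elim/(@pm_quotW R (residue_premodule p)): k => -[a s]; exists a, s.
Qed.

Lemma frac_eq a s b t : frac a s = frac b t <-> p (a * val t - b * val s).
Proof. exact: pm_piP. Qed.

Lemma scale_frac c a s : c *: frac a s = frac (c * a) s.
Proof. exact: pmq_scaleE. Qed.

Lemma frac0 s : frac 0 s = 0.
Proof. by rewrite -(mul0r 0) -scale_frac scale0r. Qed.

Lemma frac_scale_eq0 c : c *: frac 1 (outside1 p) = 0 <-> p c.
Proof.
rewrite scale_frac mulr1 -(frac0 (outside1 p)) frac_eq /=.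
by rewrite mul0r subr0 mulr1.
Qed.

Lemma residue_divP c (k : residue_field p) : ~ p c -> exists k', c *: k' = k.
Proof.
move=> pc; have [a [s ->]] := fracP k.
exists (frac a (outsideM (to_outside pc) s)); rewrite scale_frac.
by apply/frac_eq/ideal_eq0 => /=; ring.
Qed.

Lemma residue_scale_inj c (k k' : residue_field p) :
  ~ p c -> c *: k = c *: k' -> k = k'.
Proof.
move=> pc; have [[a [s ->]] [b [t ->]]] := (fracP k, fracP k').
rewrite !scale_frac => /frac_eq pab; apply/frac_eq.
suff : p (c * (a * val t - b * val s)) by case/prime_mul.
by move: pab; congr (p _); ring.
Qed.

(** Clearing a common denominator. *)
Lemma tensor_clear (M : lmodType R) (u : tensor M (residue_field p)) :
  exists (t : R) (m : M), ~ p t /\ t *: u = pure m (frac 1 (outside1 p)).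
Proof.
have [s ->] := tensorP u; elim: s => [|[m k] s [t [m' [pt IH]]]].
  exists 1, 0; split; first exact: prime_proper.
  by rewrite big_nil scaler0 pure0l.
have [a [w ->]] := fracP k.
exists (t * val w), ((t * a) *: m + val w *: m'); split.
  by move/prime_mul => [//|]; apply: outsideP.
rewrite big_cons scalerDr [t * val w]mulrC -[_ *: (\sum_(_ <- _) _)]scalerA IH.
rewrite pureDl pureZl pureZl; congr (_ + _) => /=.
rewrite -!pureZr !scale_frac; congr (pure _ _); apply/frac_eq/ideal_eq0 => /=.
by ring.
Qed.
End ResidueFieldTheory.

(** * From acyclicity over residue fields to local vanishing of homology *)

Section LocalVanishing.
Variables (R : comPzRingType) (noethR : noetherian R).

(* For projective M this is aM. *)
Definition ideal_mul (a : ideal R) (M : lmodType R) : submodule M.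
Proof.
exists (fun x => forall c : {linear M -> R^o}, a (c x)).
  by move=> c; rewrite linear0; apply: submodule0.
by move=> b u v au av c; rewrite linearP; apply: submoduleP.
Defined.

Lemma ideal_mul_linear a (M N : lmodType R) (f : {linear M -> N}) x :
  ideal_mul a M x -> ideal_mul a N (f x).
Proof. by move=> ax c; apply: (ax (c \o f)). Qed.

Lemma ideal_mulW (a b : ideal R) (M : lmodType R) x :
  (forall r, a r -> b r) -> ideal_mul a M x -> ideal_mul b M x.
Proof. by move=> ab ax c; apply/ab/ax. Qed.

Lemma ideal_mulZ (a : ideal R) (M : lmodType R) r (x : M) :
  a r -> ideal_mul a M (r *: x).
Proof.
by move=> ar c; rewrite linearZ; apply: idealMr.
Qed.

Lemma ideal_mul_colon (a : ideal R) s (M : lmodType R) (x : M) :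
  ideal_mul a M (s *: x) -> ideal_mul (colon (M := R^o) a s) M x.
Proof.
move=> asx c /=; have -> : c x *: (s : R^o) = s *: c x by exact: mulrC.
by rewrite -linearZ.
Qed.

Definition ideal_adjoin (a : ideal R) (t : R) : ideal R.
Proof.
exists (fun x => exists y c, a y /\ x = y + c * t).
  by exists 0, 0; rewrite mul0r addr0; split=> //; apply: submodule0.
move=> b _ _ [y [c [ay ->]]] [y' [c' [ay' ->]]].
exists (b *: (y : R^o) + y'), (b * c + c'); split; first exact: submoduleP.
by rewrite scalerDr addrACA mulrDl -[b * c * t]mulrA.
Defined.

Lemma ideal_lt_adjoin (a : ideal R) t : ~ a t -> ideal_lt a (ideal_adjoin a t).
Proof.
move=> nat; split=> [x ax|]; first by exists x, 0; rewrite mul0r addr0.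
exists t; split=> //; exists 0, 1; rewrite mul1r add0r; split=> //.
exact: submodule0.
Qed.

Lemma ideal_mul_adjoin (a : ideal R) t (M : lmodType R) x :
  dual_basis M -> ideal_mul (ideal_adjoin a t) M x ->
  exists y z, ideal_mul a M y /\ x = y + t *: z.
Proof.
move=> [K [e [c cE]]] ax; have [s xE] := cE x.
have /choice[f fE] : forall k, exists yz : R * R,
    a yz.1 /\ (c k x : R) = yz.1 + yz.2 * t.
  by move=> k; have [y [z yz]] := ax (c k); exists (y, z).
exists (\sum_(k <- s) (f k).1 *: e k), (\sum_(k <- s) (f k).2 *: e k); split.
  apply: submodule_sum => k; apply: ideal_mulZ; exact: (fE k).1.
rewrite scaler_sumr -big_split {1}xE; apply: eq_bigr => k _ /=.
by rewrite (fE k).2 scalerA [t * _]mulrC scalerDl.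
Qed.

(** A functional d on M induces a map from M (x) kappa(q) to kappa(q), which reads off d x modulo
    q. *)
Lemma ideal_mul_pure (q : Spec R) (M : lmodType R) (x : M) : dual_basis M ->
  ideal_mul q M x <-> pure x (frac 1 (outside1 q)) = 0.
Proof.
move=> [K [e [c cE]]]; split=> [qx|px0 d].
  have [s ->] := cE x; rewrite pure_suml big1 // => k _.
  rewrite pureZl -pureZr; have /frac_scale_eq0 -> := qx (c k).
  by rewrite -(scale0r 0) pureZr scale0r.
have [||||h hE] := @tensor_lift R M (residue_field q) (residue_field q)
    (fun m k => (d m : R) *: k).
- by move=> m m' n; rewrite linearD scalerDl.
- by move=> m n n'; rewrite scalerDr.
- by move=> a m n; rewrite linearZ scalerA.
- by move=> a m n; rewrite !scalerA mulrC.
by apply/frac_scale_eq0; rewrite -hE px0 linear0.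
Qed.

Variables (P : cpx R) (basisP : forall i, dual_basis (P i)) (p : Spec R).
Hypothesis acP : forall q : Spec R, (forall r, q r -> p r) ->
  acyclic (tensor_cpx P (residue_field q)).

(** Larger ideals come first, and an ideal not inside p is trivial. The degree varies in the
    induction because the prime case calls the statement one degree lower. *)
Lemma cycle_mod_ideal (a : ideal R) (i : int) (x : P i) :
  ideal_mul a _ (diff P i (i + 1) x) ->
  exists (r : R) (b : P i),
    [/\ ~ p r, boundary b & ideal_mul a (P i) (r *: x - b)].
Proof.
elim/(noetherian_ind noethR): a i x => a IH i x adx.
have [[r [ar npr]]|nap] := pselect (exists r : R, a r /\ ~ p r).
  exists r, 0; split=> //; first exact: boundary0.
  by rewrite subr0; apply: ideal_mulZ.
have ap r : a r -> p r.
  by move=> ar; apply: contrapT => npr; apply: nap; exists r.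
have [|[q qE]|[s [t [st ns nt]]]] := @prime_or_zero_divisor R a.
- by move/ap; apply: prime_proper.
(* Prime case: acyclicity over kappa(q) gives [t] outside q with t x - dy in qP. So y is a cycle
   modulo q + (t), and induction yields r y - b = al + t v. Then t (r x - dv) lies in qP, and t
   cancels. *)
- pose one := frac 1 (outside1 q).
  have aM (M : lmodType R) (y : M) : ideal_mul a M y <-> ideal_mul q M y.
    by split=> ay c; apply/qE/ay.
  have cx : cycle (X := tensor_cpx P (residue_field q)) (pure x one).
    rewrite /cycle [LHS]tensor_map_pure; apply/ideal_mul_pure => //.
    exact/aM.
  have [k kE] := intS i; subst i.
  have [|u uE] := boundaryP (acP _ cx); first by move=> r /qE/ap.
  have [t [y [nqt tu]]] := tensor_clear u.
  have at_ : ~ a t by move/qE.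
  have tx : ideal_mul a _ (t *: x - diff P k (k + 1) y).
    apply/aM/ideal_mul_pure => //.
    rewrite pureDl -scaleN1r !pureZl -uE.
    rewrite -[pure (diff _ _ _ y) _]tensor_map_pure.
    by rewrite -tu linearZ scaleN1r [X in _ - X]/= subrr.
  have [|r [b [npr bb]]] := IH _ (ideal_lt_adjoin at_) k y.
    have -> : diff P k (k + 1) y = t *: x - (t *: x - diff P k (k + 1) y).
      by rewrite opprB [RHS]addrC subrK.
    apply: submoduleB; last exact: ideal_mulW (ideal_lt_adjoin at_).1 tx.
    apply: ideal_mulZ; exists 0, 1; rewrite mul1r add0r; split=> //.
    exact: submodule0.
  move=> /(ideal_mul_adjoin (basisP k))[al [v [aal rE]]].
  exists r, (diff P k (k + 1) v); split=> //; first by exists k, v.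
  have : ideal_mul a _ (t *: (r *: x - diff P k (k + 1) v)).
    have := congr1 (diff P k (k + 1)) rE.
    rewrite linearB (boundary_cycle bb) subr0 linearD !linearZ => rdy.
    have -> : t *: (r *: x - diff P k (k + 1) v) =
        r *: (t *: x - diff P k (k + 1) y) + diff P k (k + 1) al.
      rewrite scalerBr scalerBr rdy opprD !scalerA [t * r]mulrC.
      by rewrite addrA addrAC subrK.
    by apply: submoduleD; [exact: submoduleZ | exact: ideal_mul_linear].
  move=> tz c; have := tz c; rewrite linearZ => /qE/prime_mul[/qE //|/qE//].
(* Non-prime case: induction for a + (s) gives r x - b = al + s z. Since s dz lies in aP, z is a
   cycle modulo (a : s), which is larger because it contains t; induction for that ideal, multiplied
   by s, returns to aP. *)
have [|r [b [npr bb]]] := IH _ (ideal_lt_adjoin ns) i x.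
  exact: ideal_mulW (ideal_lt_adjoin ns).1 adx.
move=> /(ideal_mul_adjoin (basisP i))[al [z [aal rE]]].
have lt_colon : ideal_lt a (colon (M := R^o) a s).
  split=> [y ay|] /=; first exact: idealMr.
  by exists t; rewrite [_ *: _]mulrC.
have [|r' [b' [npr' bb' cz]]] := IH _ lt_colon i z.
  apply: ideal_mul_colon.
  have -> : s *: diff P i (i + 1) z =
      r *: diff P i (i + 1) x - diff P i (i + 1) al.
    have := congr1 (diff P i (i + 1)) rE.
    rewrite linearB (boundary_cycle bb) subr0 linearD !linearZ => ->.
    by rewrite [RHS]addrC addKr.
  by apply: submoduleB; [exact: submoduleZ | exact: ideal_mul_linear].
exists (r' * r), (r' *: b + s *: b'); split.
- by move/prime_mul => [].
- by apply: boundaryD; apply: boundaryZ.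
have -> : (r' * r) *: x - (r' *: b + s *: b') = r' *: al + s *: (r' *: z - b').
  have -> : al = r *: x - b - s *: z by rewrite rE addrK.
  rewrite !scalerBr !scalerA [s * r']mulrC opprD.
  by rewrite !addrA subrK.
apply: submoduleD; first exact: submoduleZ.
move: (r' *: z - b') cz => w cw c; rewrite linearZ.
exact: (eq_ind_r (submodule_set a) (cw c) (mulrC s (c w))).
Qed.

Lemma local_boundary (i : int) (x : P i) : cycle x ->
  exists2 r : R, ~ p r & boundary (r *: x).
Proof.
move=> cx; pose zero := @Submodule R R^o (fun x => x = 0) erefl
  (fun a u v (u0 : u = 0) (v0 : v = 0) => etrans
     (congr2 (fun u v => a *: u + v) u0 v0) (etrans (addr0 _) (scaler0 _ a))).
have [|r [b [npr bb H]]] := @cycle_mod_ideal zero i x.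
  by rewrite [diff _ _ _ _]cx; apply: submodule0.
exists r => //; suff /eqP -> : r *: x == b by [].
rewrite -subr_eq0; have [K [e [c cE]]] := basisP i.
have [s ->] := cE (r *: x - b); rewrite big1 // => k _.
by rewrite (H (c k)) scale0r.
Qed.
End LocalVanishing.

(** * Localization at a prime *)

Section Localization.
Variables (R : comPzRingType) (p : Spec R).
Implicit Types M N : lmodType R.

Definition loc_rel M (x y : M * outside p) : Prop :=
  exists2 u : R, ~ p u & u *: (val y.2 *: x.1) = u *: (val x.2 *: y.1).

Lemma loc_rel_eq M (x y : M * outside p) :
  val y.2 *: x.1 = val x.2 *: y.1 -> loc_rel x y.
Proof. by move=> e; exists 1; [apply: (@prime_proper _ p) | rewrite e]. Qed.

Definition loc_premodule M : premodule R.
Proof.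
apply: (@Premodule R (M * outside p : choiceType)%type (@loc_rel M)
  (0, outside1 p) (fun x => (- x.1, x.2))
  (fun x y => (val y.2 *: x.1 + val x.2 *: y.1, outsideM x.2 y.2))
  (fun a x => (a *: x.1, x.2))).
- by move=> x; apply: loc_rel_eq.
- by move=> x y [u pu e]; exists u.
- move=> [x s] [y t] [z w] [u pu /= e] [v pv /= e'].
  exists (u * v * val t) => /=.
    by case/prime_mul => [/prime_mul[]//|]; apply: outsideP.
  have -> : (u * v * val t) *: (val w *: x) =
      (v * val w) *: (u *: (val t *: x)).
    by rewrite !scalerA; congr (_ *: _) => /=; ring.
  rewrite e scalerA (_ : v * val w * u = u * (v * val w)); last by ring.
  have -> : (u * (v * val w)) *: (val s *: y) =
      (u * val s) *: (v *: (val w *: y)).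
    by rewrite !scalerA; congr (_ *: _) => /=; ring.
  by rewrite e' !scalerA; congr (_ *: _) => /=; ring.
- by move=> [x s] [y t] [u pu /= e]; exists u; rewrite //= !scalerN e.
- move=> [x s] [x' s'] [y t] [y' t'] [u pu /= e] [v pv /= e'].
  exists (u * v); first by case/prime_mul.
  rewrite /= !scalerDr; congr (_ + _).
    have -> : (u * v) *: ((val s' * val t') *: (val t *: x)) =
        (v * val t' * val t) *: (u *: (val s' *: x)).
      by rewrite !scalerA; congr (_ *: _) => /=; ring.
    by rewrite e !scalerA; congr (_ *: _) => /=; ring.
  have -> : (u * v) *: ((val s' * val t') *: (val s *: y)) =
      (u * val s' * val s) *: (v *: (val t' *: y)).
    by rewrite !scalerA; congr (_ *: _) => /=; ring.
  by rewrite e' !scalerA; congr (_ *: _) => /=; ring.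
- move=> a [x s] [y t] [u pu /= e]; exists u => //=.
  have E b c (z : M) : b *: (c *: (a *: z)) = a *: (b *: (c *: z)).
    by rewrite !scalerA; congr (_ *: _) => /=; ring.
  by rewrite !E e.
- move=> [x s] [y t] [z w]; apply: loc_rel_eq => /=.
  rewrite !scalerDr !scalerA -!addrA.
  by congr (_ *: _ + (_ *: _ + _ *: _)) => /=; ring.
- move=> [x s] [y t]; apply: loc_rel_eq => /=.
  rewrite addrC !scalerDr !scalerA.
  by congr (_ *: _ + _ *: _) => /=; ring.
- move=> [x s]; apply: loc_rel_eq => /=.
  by rewrite scaler0 add0r scale1r mul1r.
- move=> [x s]; apply: loc_rel_eq => /=.
  by rewrite scalerN addNr !scaler0.
- by move=> a b [x s]; apply: loc_rel_eq; rewrite /= scalerA.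
- by move=> [x s]; apply: loc_rel_eq; rewrite /= scale1r.
- move=> a [x s] [y t]; apply: loc_rel_eq => /=.
  rewrite !scalerDr !scalerA.
  by congr (_ *: _ + _ *: _) => /=; ring.
- move=> a b [x s]; apply: loc_rel_eq => /=.
  rewrite scalerDl !scalerDr !scalerA.
  by congr (_ *: _ + _ *: _) => /=; ring.
Defined.

Definition loc M : lmodType R := pm_lmod (loc_premodule M).

Definition loc_frac M (x : M) (s : outside p) : loc M :=
  pm_pi (M := loc_premodule M) (x, s).

Lemma locP M (z : loc M) : exists x s, z = loc_frac x s.
Proof.
by elim/(@pm_quotW R (loc_premodule M)): z => -[x s]; exists x, s.
Qed.

Lemma loc_frac_eq M (x y : M) s t : loc_frac x s = loc_frac y t <->
  exists2 u : R, ~ p u & u *: (val t *: x) = u *: (val s *: y).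
Proof. exact: pm_piP. Qed.

Lemma loc_fracD M (x y : M) s t :
  loc_frac x s + loc_frac y t =
  loc_frac (val t *: x + val s *: y) (outsideM s t).
Proof. exact: pmq_addE. Qed.

Lemma loc_fracZ M a (x : M) s : a *: loc_frac x s = loc_frac (a *: x) s.
Proof. exact: pmq_scaleE. Qed.

Lemma loc_frac0 M s : loc_frac (0 : M) s = 0.
Proof. by rewrite -(scale0r (0 : M)) -loc_fracZ scale0r. Qed.

Lemma loc_in_linear M : linear (fun x : M => loc_frac x (outside1 p)).
Proof.
move=> a x y; rewrite loc_fracZ loc_fracD; apply/loc_frac_eq.
exists 1; first exact: (@prime_proper _ p).
by rewrite /= mul1r !scale1r.
Qed.

Definition loc_in M : {linear M -> loc M} := mklin (@loc_in_linear M).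

Lemma loc_map_spec M N (f : {linear M -> N}) :
  {g : {linear loc M -> loc N} |
    forall x s, g (loc_frac x s) = loc_frac (f x) s}.
Proof.
pose g (z : pm_quot (loc_premodule M)) : loc N :=
  loc_frac (f (repr z).1) (repr z).2.
have fZ a y : f (a *: y) = a *: f y by rewrite linearZ.
have gE x s : g (loc_frac x s) = loc_frac (f x) s.
  have [u pu /= e] := pm_reprP (M := loc_premodule M) (x, s).
  apply/loc_frac_eq; exists u => //.
  by move: (congr1 f e); rewrite !fZ.
have lin : linear (g : loc M -> loc N).
  move=> a z w; have [[x [s ->]] [y [t ->]]] := (locP z, locP w).
  rewrite loc_fracZ loc_fracD !gE loc_fracZ loc_fracD.
  by rewrite linearD !fZ.
by exists (mklin lin) => x s; apply: gE.
Qed.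

Definition loc_map M N (f : {linear M -> N}) : {linear loc M -> loc N} :=
  sval (loc_map_spec f).

Lemma loc_mapE M N (f : {linear M -> N}) x s :
  loc_map f (loc_frac x s) = loc_frac (f x) s.
Proof. exact: (svalP (loc_map_spec f)). Qed.

Definition loc_cpx (X : cpx R) : cpx R.
Proof.
exists (fun i => loc (X i)) (fun i j => loc_map (diff X i j)).
- move=> i j z ij; have [x [s ->]] := locP z.
  by rewrite loc_mapE diff_shape // loc_frac0.
- move=> i j k z; have [x [s ->]] := locP z.
  by rewrite !loc_mapE diffK loc_frac0.
Defined.

Definition loc_cmap (X : cpx R) : cmap X (loc_cpx X).
Proof.
by exists (fun i => loc_in (X i)) => i j x; rewrite [RHS]loc_mapE.
Defined.

Lemma loc_acyclic (X : cpx R) :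
  (forall i (x : X i), cycle x -> exists2 r : R, ~ p r & boundary (r *: x)) ->
  acyclic (loc_cpx X).
Proof.
move=> bX i z; have [x [s ->]] := locP z.
rewrite /cycle [LHS]loc_mapE -(loc_frac0 _ (outside1 p)).
case/loc_frac_eq => u pu /=; rewrite scale1r !scaler0 => ux.
have [|r pr [j [y dy]]] := bX i (u *: x); first by rewrite /cycle linearZ.
have pru : ~ p (r * u) by case/prime_mul.
exists j, (loc_frac y (outsideM (to_outside pru) s)).
rewrite [LHS]loc_mapE dy; apply/loc_frac_eq; exists 1.
  exact: (@prime_proper _ p).
by rewrite !scale1r !scalerA; congr (_ *: _) => /=; ring.
Qed.

(* M_p (x) k(p) -> M (x) k(p), which exists because the elements outside p act
   bijectively on k(p). *)
Lemma loc_tensor M : exists h : {linear tensor (loc M) (residue_field p) ->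
    tensor M (residue_field p)},
  forall (x : M) s k, h (pure (loc_frac x s) (val s *: k)) = pure x k.
Proof.
have /choice[div divE] (sk : outside p * residue_field p) :
    exists k', val sk.1 *: k' = sk.2.
  by apply: residue_divP; apply: outsideP.
pose b (z : pm_quot (loc_premodule M)) k :=
  pure (repr z).1 (div ((repr z).2, k)).
have bE (x : M) s k : b (loc_frac x s) (val s *: k) = pure x k.
  have [u pu /= e] := pm_reprP (M := loc_premodule M) (x, s).
  rewrite /b; move: (repr _) e => [y t] /= e.
  have pus : ~ p (u * val s) by case/prime_mul => //; apply: outsideP.
  have [l lE] := residue_divP (div (t, val s *: k)) pus.
  rewrite -lE pureZr -pureZl -scalerA e scalerA pureZl -pureZr.
  congr (pure _ _).
  apply: (residue_scale_inj (@outsideP _ _ s)).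
  apply: etrans (divE (t, val s *: k)); rewrite -lE !scalerA.
  by congr (_ *: _) => /=; ring.
have bP (z : loc M) (k : residue_field p) :
    exists (x : M) s k', z = loc_frac x s /\ k = val s *: k'.
  have [x [s ->]] := locP z.
  have [k' kE] := residue_divP k (@outsideP _ _ s).
  by exists x, s, k'.
have [||||h hE] := @tensor_lift R (loc M) (residue_field p) _ b; last first.
- by exists h => x s k; rewrite hE bE.
- move=> a z k; have [x [s [k' [-> ->]]]] := bP z k.
  have -> : a *: (val s *: k') = val s *: (a *: k') by rewrite !scalerA mulrC.
  by rewrite !bE pureZr.
- move=> a z k; have [x [s [k' [-> ->]]]] := bP z k.
  by rewrite loc_fracZ !bE pureZl.
- move=> z k k'; have [x [s ->]] := locP z.
  have [l <-] := residue_divP k (@outsideP _ _ s).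
  have [l' <-] := residue_divP k' (@outsideP _ _ s).
  by rewrite -scalerDr !bE pureDr.
move=> z z' k; have [[x [s ->]] [y [t ->]]] := (locP z, locP z').
have [l <-] := residue_divP k (@outsideP _ _ (outsideM s t)).
rewrite loc_fracD bE /= pureDl !pureZl -!pureZr.
have {1}-> : (val s * val t) *: l = val s *: (val t *: l) by rewrite scalerA.
have -> : (val s * val t) *: l = val t *: (val s *: l).
  by rewrite scalerA mulrC.
by rewrite !bE.
Qed.

(** The localization P_p is acyclic, so P -> P_p is null-homotopic. After tensoring with kappa(p)
    and composing with the map of [loc_tensor], the identity of P (x) kappa(p) is null-homotopic. *)
Lemma tensor_residue_acyclic (P : cpx R) : K_projective P ->
  (forall i (x : P i), cycle x -> exists2 r : R, ~ p r & boundary (r *: x)) ->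
  acyclic (tensor_cpx P (residue_field p)).
Proof.
move=> projP /loc_acyclic acL.
have [|h hE] := @homotopicP R P (loc_cpx P) (loc_cmap P) (cmap0 P (loc_cpx P)).
  apply: projP => //; apply: (cycleB (X := Hom_cpx P (loc_cpx P)));
  exact: cmap_cochain_cycle.
pose beta i := sval (cid (loc_tensor (P i))).
have betaE i := svalP (cid (loc_tensor (P i))); rewrite -/(beta _) in betaE.
have beta_nat i j v : beta j (tensor_map _ (loc_map (diff P i j)) v) =
    tensor_map (residue_field p) (diff P i j) (beta i v).
  pose f : {linear _ -> tensor (P j) (residue_field p)} :=
    beta j \o tensor_map (residue_field p) (loc_map (diff P i j)).
  pose g : {linear _ -> tensor (P j) (residue_field p)} :=
    tensor_map (residue_field p) (diff P i j) \o beta i.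
  apply: (@tensor_ext _ _ _ _ f g) => z k; rewrite /f /g.
  rewrite -[LHS]/(beta j (tensor_map _ (loc_map (diff P i j)) (pure z k))).
  rewrite -[RHS]/(tensor_map _ (diff P i j) (beta i (pure z k))).
  have [x [s ->]] := locP z.
  have [l <-] := residue_divP k (@outsideP _ _ s).
  by rewrite tensor_map_pure loc_mapE !betaE tensor_map_pure.
move=> i; have [k kE] := intS i; subst i => u cu.
pose K := residue_field p.
pose s : {linear tensor (P (k + 1)) K -> tensor (loc (P (k + 1))) K} :=
  tensor_map K (loc_in (P (k + 1))).
pose t : {linear tensor (P (k + 1)) K -> tensor (loc (P (k + 1))) K} :=
  (tensor_map K (loc_map (diff P k (k + 1))) \o tensor_map K (h k))
  \+ (tensor_map K (h (k + 1)) \o tensor_map K (diff P (k + 1) (k + 1 + 1))).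
have tE v : t v =
    tensor_map K (loc_map (diff P k (k + 1))) (tensor_map K (h k) v) +
    tensor_map K (h (k + 1)) (tensor_map K (diff P (k + 1) (k + 1 + 1)) v).
  by [].
have st : s u = t u.
  apply: tensor_ext => x l; rewrite tE !tensor_map_pure -pureDl.
  by rewrite hE /= subr0.
have uE : u = beta _ (s u).
  pose f : {linear tensor (P (k + 1)) K -> _} := beta (k + 1) \o s.
  apply: (@tensor_ext _ _ _ _ idfun f) => x l.
  rewrite -[RHS]/(beta (k + 1) (tensor_map K (loc_in _) (pure x l))).
  rewrite tensor_map_pure.
  by have := betaE (k + 1) x (outside1 p) l; rewrite scale1r.
exists k, (beta k (tensor_map K (h k) u)).
rewrite [RHS]uE st tE [X in _ + tensor_map _ _ X]cu linear0 addr0.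
by rewrite beta_nat.
Qed.
End Localization.

(** * Cochains with values in a bounded complex of injectives *)

Section LocalHomology.
Variables (R : comPzRingType) (p : Spec R).

(** The vanishing of H^i(X)_p. *)
Definition local_exact (X : cpx R) (i : int) : Prop :=
  forall x : X i, cycle x -> exists2 r : R, ~ p r & boundary (r *: x).

Lemma quasi_iso_local_exact (X Y : cpx R) (s : cmap X Y) i :
  quasi_iso s -> local_exact X i <-> local_exact Y i.
Proof.
move=> qs; split=> [eX y cy|eY x cx].
  have [x cx bx] := (qs i).2 y cy; have [r pr bxr] := eX x cx.
  exists r => //; rewrite -[y](subrK (s i x)) scalerDr; apply: boundaryD.
    exact: boundaryZ.
  by rewrite -linearZ; apply: boundary_cmap.
have [r pr] := eY _ (cycle_cmap s cx); rewrite -linearZ => br.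
exists r => //; apply: (qs i).1 => //.
by rewrite /cycle linearZ /= cx scaler0.
Qed.
End LocalHomology.

(** The forward direction tests [supp] on the semifree resolution, whose terms have dual bases; the
    converse must treat every K-projective resolution. *)
Lemma supp_local_exact (R : comPzRingType) (W : Spec R -> Prop) (X : cpx R) :
  noetherian R -> specialization_closed W ->
  (forall p, supp X p -> W p) <->
  (forall p, ~ W p -> forall i, local_exact p X i).
Proof.
move=> noethR closedW; split=> [sW p nWp i|eX p [P nac]].
  have qP := kp_qiso (semifree_resolution X).
  apply/(quasi_iso_local_exact p i qP) => x cx.
  have basis j : dual_basis (semifree X j) by apply: free_dual_basis.
  apply: (@local_boundary R noethR (semifree X) basis p _ i x cx) => q qp.
  apply: contrapT => nac; apply: nWp; apply: (closedW q) => //.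
  by apply: sW; exists (semifree_resolution X).
apply: contrapT => nWp; apply: nac; apply: tensor_residue_acyclic => [|i].
  exact: kp_projective.
exact/(quasi_iso_local_exact p i (@kp_qiso _ _ P))/eX.
Qed.

Lemma injective_extend (R : pzRingType) (U V E : lmodType R)
    (d : {linear U -> V}) (f : {linear U -> E}) : injective_module E ->
  (forall x, d x = 0 -> f x = 0) ->
  exists e : {linear V -> E}, forall x, e (d x) = f x.
Proof.
move=> injE df; have fE x y : d x = d y -> f x = f y.
  move=> dxy; apply/eqP; rewrite -subr_eq0 -linearB; apply/eqP/df.
  by rewrite linearB dxy subrr.
have [B BE] : exists B : submodule V, forall v, B v <-> exists x, d x = v.
  unshelve eexists (@Submodule R V (fun v => exists x, d x = v) _ _) => //.
    by exists 0; rewrite linear0.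
  by move=> a _ _ [x <-] [y <-]; exists (a *: x + y); rewrite linearP.
have pre (v : submodule_lmod B) : {x | d x = val v}.
  exact/cid/BE/submodule_typeP.
have lf : linear (fun v : submodule_lmod B => f (sval (pre v))).
  move=> a v w /=; rewrite -linearP; apply: fE.
  by rewrite (svalP (pre _)) linearP !(svalP (pre _)).
have lv : linear (fun v : submodule_lmod B => val v) by [].
have [|e eE] := injE _ _ (mklin lv) (mklin lf); first exact: val_inj.
exists e => x; have Bx : B (d x) by apply/BE; exists x.
rewrite -[d x]/(mklin lv (to_submodule Bx)) eE; apply: fE.
exact: (svalP (pre _)).
Qed.

Lemma koszul_signK (R : comPzRingType) (V : lmodType R) m (v : V) :
  koszul_sign R m *: (koszul_sign R m *: v) = v.
Proof. by rewrite scalerA -exprMn mulrNN mulr1 expr1n scale1r. Qed.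

(** * The torsion subcomplex and cochains with values in it *)

Section TorsionSubcomplex.
Variables (R : comPzRingType) (W : Spec R -> Prop).

Definition torsion_cpx (X : cpx R) : cpx R.
Proof.
exists (fun i => submodule_lmod (torsion W (X i)))
       (fun i j => restrict (@torsion_linear R W (X i) (X j) (diff X i j))).
- by move=> i j x ij; apply: val_inj; apply: diff_shape.
- by move=> i j k x; apply: val_inj; apply: diffK.
Defined.

Definition torsion_incl (X : cpx R) : cmap (torsion_cpx X) X.
Proof.
unshelve refine (@Cmap R (torsion_cpx X) X (fun i =>
  @mklin R (submodule_lmod (torsion W (X i))) (X i) val _) _); by [].
Defined.

Lemma torsion_cpx_local_exact (X : cpx R) p i :
  ~ W p -> local_exact p (torsion_cpx X) i.
Proof.
move=> nWp x _; have [r pr rx] := submodule_typeP x p nWp; exists r => //.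
have -> : r *: x = 0 by apply: val_inj.
exact: boundary0.
Qed.

Section HomTorsion.
Variables (P I : cpx R).
Notation T := (torsion W _).

Lemma Hom_torsion_incl_inj m (f g : cochain P (torsion_cpx I) m) :
  Hom_map P (torsion_incl I) m f = Hom_map P (torsion_incl I) m g -> f = g.
Proof.
move=> fg; apply: cochain_ext => p q x; apply: val_inj.
exact: (congr1 (fun h : cochain P I m => h p q x) fg).
Qed.

Lemma torsion_cochain m (h : cochain P I m) :
  (forall p q x, T (h p q x)) ->
  exists f, Hom_map P (torsion_incl I) m f = h.
Proof.
move=> Th; unshelve eexists (@Cochain R P (torsion_cpx I) m (fun p q =>
  @mklin R (P p) (submodule_lmod (torsion W (I q)))
    (fun x => to_submodule (Th p q x)) _) _).
- by move=> a x y; apply: val_inj; rewrite /= linearP.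
- by move=> p q x pq; apply: val_inj; apply: cochain_shape.
- exact: cochain_ext.
Qed.

Variables (psi : forall i, {linear I i -> I i}).
Hypothesis psiT : forall i x, T (psi i x).
Hypothesis psi_id : forall i x, T x -> psi i x = x.
Hypothesis injI : forall i, injective_module (I i).

(* Modulo torsion, h vanishes in codegrees < q0, hence kills boundaries in
   degree p0; as H^p0(P) is torsion and I / T is not, it also kills cycles. *)
Lemma torsion_step (m p0 q0 : int) (h : cochain P I (m + 1)) :
  q0 = p0 + (m + 1) ->
  (forall p, ~ W p -> local_exact p P p0) ->
  (forall p q x, q < q0 -> T (h p q x)) ->
  (forall p q x, T (cochain_diff (m + 1 + 1) h p q x)) ->
  exists k : cochain P I m, forall p q x, q <= q0 ->
    T ((h - cochain_diff (m + 1) k) p q x).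
Proof.
move=> q0E eP hT dhT.
pose f : {linear P p0 -> I q0} := h p0 q0 \- (psi q0 \o h p0 q0).
have fbd x : boundary x -> f x = 0.
  have [k kE] := intS p0; subst p0; case/boundaryP => y <-.
  rewrite /f /= psi_id ?subrr //.
  have := dhT k q0 y; rewrite cochain_diffE => dT.
  have Ty : T (diff I (q0 - 1) q0 (h k (q0 - 1) y)).
    by apply: torsion_linear; apply: hT; lia.
  rewrite -[h _ _ _](koszul_signK (m + 1)); apply: submoduleZ.
  by move: (submoduleB Ty dT); rewrite opprB addrC subrK.
have [|e eE] := @injective_extend R _ _ _ (diff P p0 (p0 + 1)) f (@injI q0).
  (* On a cycle, [f x] is torsion by [fbd], hence fixed by [psi]; but [psi] kills it, being
     idempotent. *)
  move=> x cx; rewrite -(@psi_id _ (f x)).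
    by rewrite /f /= linearB /= [X in _ - X]psi_id ?subrr.
  move=> p /eP/(_ x cx)[r pr br]; exists r => //.
  by rewrite -linearZ fbd.
(* The sign cancels the one in the differential, so that h - dk is psi h in the entry (p0, q0). The
   only other entry affected has codegree q0 + 1. *)
unshelve epose (k := (@Cochain R P I m (fun p q =>
  transport I q0 q \o (- koszul_sign R m \*: e \o transport P p (p0 + 1))) _)).
  move=> p q x pq /=; have [pE|ne] := eqVneq p (p0 + 1).
    by subst p; rewrite transport0 //; apply/eqP => ?; case/eqP: pq; lia.
  by rewrite (@transport0 _ P) // linear0 scaler0 linear0.
have k0 p q x : q != q0 -> k p q x = 0.
  by move=> ne; rewrite /= transport0 // eq_sym.
have kE x : k (p0 + 1) q0 x = - koszul_sign R m *: e x.
  by rewrite /= !transport_id.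
clearbody k; exists k => p q x le_q.
rewrite cochainDE cochainNE cochain_diffE k0 ?linear0 ?sub0r ?opprK; last first.
  by apply/eqP; lia.
have [qE|ne] := eqVneq q q0; last first.
  rewrite k0 // scaler0 addr0; apply: hT; lia.
subst q; have [pE|ne] := eqVneq p p0; last first.
  rewrite cochain_shape; last by apply/eqP => ?; case/eqP: ne; lia.
  rewrite cochain_shape; last by apply/eqP => ?; case/eqP: ne; lia.
  by rewrite scaler0 addr0; apply: submodule0.
subst p; rewrite kE scaleNr scalerN koszul_signK eE /f /=.
by rewrite opprB addrC subrK; apply: psiT.
Qed.

Variables (a : int).
Hypothesis I_lt : forall i, i < a -> forall x : I i, x = 0.

Lemma cochain_diffK m (h : cochain P I m) :
  cochain_diff (m + 1 + 1) (cochain_diff (m + 1) h) = 0.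
Proof. exact: (@diffK _ (Hom_cpx P I) m (m + 1) (m + 1 + 1) h). Qed.

Lemma cochain_diffB m m' (h k : cochain P I m) :
  cochain_diff m' (h - k) = cochain_diff m' h - cochain_diff m' k.
Proof. exact: (linearB (diff (Hom_cpx P I) m m')). Qed.

(** As I vanishes below [a], finitely many corrections reach [c], and their sum needs no limit. *)
Lemma torsion_iter (m c : int) (h : cochain P I (m + 1)) :
  (forall q, q < c -> forall p, ~ W p -> local_exact p P (q - (m + 1))) ->
  (forall p q x, T (cochain_diff (m + 1 + 1) h p q x)) ->
  exists k : cochain P I m, forall p q x, q < c ->
    T ((h - cochain_diff (m + 1) k) p q x).
Proof.
move=> eP dhT; have low (g : cochain P I (m + 1)) p q x : q < a -> T (g p q x).
  by move=> qa; rewrite (I_lt qa (g p q x)); apply: submodule0.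
have [ca|ac] := ltP c a.
  by exists 0 => p q x qc; apply: low; lia.
have [N cE] : exists N : nat, c = a + N%:Z by exists `|c - a|%N; lia.
subst c; elim: N eP {ac} => [|N IHN] eP.
  by exists 0 => p q x qc; apply: low; lia.
have [|k kT] := IHN; first by move=> q qN; apply: eP; lia.
have [||||k' k'T] := @torsion_step m (a + N%:Z - (m + 1)) (a + N%:Z)
    (h - cochain_diff (m + 1) k).
- lia.
- by apply: eP; lia.
- exact: kT.
- by move=> p q x; rewrite cochain_diffB cochain_diffK subr0.
exists (k + k') => p q x qN; have := k'T p q x.
have -> : cochain_diff (m + 1) (k + k') =
    cochain_diff (m + 1) k + cochain_diff (m + 1) k'.
  exact: (linearD (diff (Hom_cpx P I) m (m + 1))).
by rewrite opprD addrA; apply; lia.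
Qed.

(** A cochain of degree i > n - t reaches codegrees at most n only from degrees of P below t.
    Surjectivity can thus correct up to codegree n. Injectivity corrects a cochain of degree i - 1,
    for which codegree n may be fed from degree t itself; hence the bound [n] in place of
    [n + 1]. *)
Variables (n t : int).
Hypothesis I_gt : forall i, n < i -> forall x : I i, x = 0.
Hypothesis P_torsion : forall p, ~ W p -> forall i, i < t -> local_exact p P i.

Lemma Hom_torsion_incl_bij (i : int) : n - t < i ->
  (forall f : Hom_cpx P (torsion_cpx I) i, cycle f ->
     boundary (Hom_map P (torsion_incl I) i f) -> boundary f) /\
  (forall g : Hom_cpx P I i, cycle g -> exists2 f, cycle f &
     boundary (g - Hom_map P (torsion_incl I) i f)).
Proof.
move=> lt_i; split=> [f cf|g cg]; last first.
  have [m mE] := intS i; subst i.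
  have [||k kT] := @torsion_iter m (n + 1) g.
  - by move=> q qn p nWp; apply: P_torsion => //; lia.
  - by move=> p q x; rewrite [cochain_diff _ _]cg; apply: submodule0.
  have [|f fE] := @torsion_cochain _ (g - cochain_diff (m + 1) k).
    move=> p q x; have [qn|nq] := ltP q (n + 1); first exact: kT.
    by rewrite [X in T X]I_gt; [apply: submodule0 | lia].
  exists f; last first.
    by rewrite fE opprB [X in boundary X]addrC subrK; exists m, k.
  apply: Hom_torsion_incl_inj.
  rewrite (cmap_diff (Hom_map P (torsion_incl I))) fE linear0.
  by rewrite [LHS]cochain_diffB [cochain_diff _ g]cg cochain_diffK subrr.
have [m' m'E] := intS i; subst i; have [m mE] := intS m'; subst m'.
case/boundaryP => h hE.
have [||k kT] := @torsion_iter m n h.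
- by move=> q qn p nWp; apply: P_torsion => //; lia.
- by move=> p q x; rewrite [cochain_diff _ _]hE; apply: submodule_typeP.
pose e : cochain P I (m + 1) := h - cochain_diff (m + 1) k.
have de : cochain_diff (m + 1 + 1) e = Hom_map P (torsion_incl I) _ f.
  by rewrite cochain_diffB cochain_diffK subr0.
(* In codegree n the splitting replaces a correction. Composing [e] with [psi] keeps its coboundary:
   [e] is already torsion below n, its values on boundaries in codegree n are torsion by the
   equation for [de], and nothing lies above n. *)
have [psie psieE] : exists g : cochain P I (m + 1),
    forall p q x, g p q x = psi q (e p q x).
  unshelve eexists (@Cochain R P I (m + 1) (fun p q => psi q \o e p q) _) => //.
  move=> p q x pq; have e0 : e p q x = 0 by apply: cochain_shape.
  exact: etrans (congr1 (psi q) e0) (linear0 _).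
have [|e' e'E] := @torsion_cochain _ psie.
  by move=> p q x; rewrite psieE; apply: psiT.
exists (m + 1), e'; apply: Hom_torsion_incl_inj.
rewrite (cmap_diff (Hom_map P (torsion_incl I))) e'E -de.
apply: cochain_ext => p q x.
have [nq|qn] := ltP n q; first by rewrite [LHS]I_gt // [RHS]I_gt.
have eT : T (e p (q - 1) x) by apply: kT; lia.
rewrite [LHS]cochain_diffE cochain_diffE !psieE psi_id //; congr (_ - _ *: _).
apply: psi_id; have := congr1 (fun u : cochain P I _ => u p q x) de.
rewrite cochain_diffE => dex.
rewrite -[e _ _ _](koszul_signK (m + 1)); apply: submoduleZ.
have -> : koszul_sign R (m + 1) *: e (p + 1) q (diff P p (p + 1) x) =
    diff I (q - 1) q (e p (q - 1) x) - Hom_map P (torsion_incl I) _ f p q x.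
  by rewrite -dex opprB [RHS]addrC subrK.
by apply: submoduleB; [apply: torsion_linear | apply: submodule_typeP].
Qed.
End HomTorsion.
End TorsionSubcomplex.

(** * Identification of the counit *)

Section Adjunction.
Variables (C C' : category) (F : functor C C') (G : functor C' C).
Variable adj : adjunction F G.

Lemma adjoint_transpose (a : C) (b : C') (g : hom (F a) b) :
  exists f : hom a (G b), heq (compose (counit adj b) (fmap F f)) g.
Proof.
exists (compose (fmap G g) (adj_unit adj a)).
apply: heq_trans (compose_heq (heq_refl _) (fmap_comp _ _ _)) _.
apply: heq_trans (composeA _ _ _) _.
apply: heq_trans (compose_heq (heq_sym (counit_nat adj g)) (heq_refl _)) _.
apply: heq_trans (heq_sym (composeA _ _ _)) _.
apply: heq_trans (compose_heq (heq_refl _) (triangleF adj a)) _.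
exact: compose_idr.
Qed.

Lemma adjoint_inj (a : C) (b : C') (f f' : hom a (G b)) :
  heq (compose (counit adj b) (fmap F f))
      (compose (counit adj b) (fmap F f')) ->
  heq f f'.
Proof.
have E (h : hom a (G b)) : heq h
    (compose (fmap G (compose (counit adj b) (fmap F h))) (adj_unit adj a)).
  apply: heq_sym.
  apply: heq_trans (compose_heq (fmap_comp _ _ _) (heq_refl _)) _.
  apply: heq_trans (heq_sym (composeA _ _ _)) _.
  apply: heq_trans (compose_heq (heq_refl _) (adj_unit_nat adj h)) _.
  apply: heq_trans (composeA _ _ _) _.
  apply: heq_trans (compose_heq (triangleG adj b) (heq_refl _)) _.
  exact: compose_idl.
move=> ff'; apply: heq_trans (E f) (heq_trans _ (heq_sym (E f'))).
exact: compose_heq (fmap_heq G ff') (heq_refl _).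
Qed.
End Adjunction.

(** The truncation has no nonzero cycles in degrees at most n, its term there being Im d^n or
    zero. *)
Lemma trunc_gt_qiso_above (R : pzRingType) (n : int) (X Y : cpx R)
    (f : cmap X Y) :
  (forall i, n < i ->
     (forall x : X i, cycle x -> boundary (f i x) -> boundary x) /\
     (forall y : Y i, cycle y ->
        exists2 x : X i, cycle x & boundary (y - f i x))) ->
  quasi_iso (trunc_gt_map n f).
Proof.
move=> qf i; have [le_in|lt_ni] := leP i n.
  split=> [z /(trunc_gt_cycle_le le_in) -> _|z /(trunc_gt_cycle_le le_in) ->].
    exact: boundary0.
  exists 0; first by rewrite /cycle linear0.
  by rewrite linear0 subr0; exact: boundary0.
have [fi fs] := qf i lt_ni; split=> [z cz|z cz].
  rewrite !(trunc_gt_boundary _ lt_ni) /=; apply: fi.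
  by case: (trunc_gt_cycle_gt z lt_ni) => _; apply.
have [z2 /(_ cz)/fs[x cx bx]] := trunc_gt_cycle_gt z lt_ni.
exists (to_submodule (trunc_gt_in x lt_ni)).
  by apply: val_inj; rewrite /= cx linear0 addr0.
by apply/(trunc_gt_boundary _ lt_ni); rewrite /=.
Qed.

Lemma trunc_le_local_exact (R : comPzRingType) (p : Spec R) (n : int)
    (X : cpx R) :
  (forall i, local_exact p (trunc_le n X) i) ->
  forall i, i <= n -> local_exact p X i.
Proof.
move=> eX i le_in x cx.
have Tx : trunc_le_submodule n X i x by split=> //; lia.
have [|r pr [j [y /(congr1 val) /= yx]]] := eX i (to_submodule Tx).
  exact: val_inj.
by exists r => //; exists j, (val y).
Qed.

(** * Universal property of the torsion subcomplex *)

Section CounitFactorization.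
Variables (R : comPzRingType) (W : Spec R -> Prop) (I : cpx R) (a n : int).
Variable psi : forall i, {linear I i -> I i}.
Hypothesis psiT : forall i x, torsion W (I i) (psi i x).
Hypothesis psi_id : forall i x, torsion W (I i) x -> psi i x = x.
Hypothesis injI : forall i, injective_module (I i).
Hypothesis I_lt : forall i, i < a -> forall x : I i, x = 0.
Hypothesis I_gt : forall i, n < i -> forall x : I i, x = 0.
Let G := torsion_cpx W I.
Let j : cmap G I := torsion_incl W I.

Lemma Hom_torsion_bij0 Q : (forall p, ~ W p -> forall i, local_exact p Q i) ->
  (forall f : Hom_cpx Q G 0, cycle f ->
     boundary (Hom_map Q j 0 f) -> boundary f) /\
  (forall g : Hom_cpx Q I 0, cycle g -> exists2 f, cycle f &
     boundary (g - Hom_map Q j 0 f)).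
Proof.
move=> eQ.
(* The source is locally exact in all degrees, and n + 1 is the least t that admits degree 0. *)
apply: (Hom_torsion_incl_bij psiT psi_id injI I_lt (t := n + 1) I_gt).
  by move=> p nWp i _; apply: eQ.
by lia.
Qed.

Lemma lift_torsion Z (f : dhom Z I) :
  (forall p, ~ W p -> forall i, local_exact p Z i) ->
  exists g : dhom Z G, deq (dhom_comp (dhom_map j) g) f.
Proof.
move=> eZ; pose Q := semifree_resolution Z.
have [g fg] := dhom_K_projective f (kp_map Q) (@kp_projective _ _ Q).
have [|_ /(_ _ (cmap_cochain_cycle g))[c cc bc]] := @Hom_torsion_bij0 Q.
  by move=> p nWp i; apply/(quasi_iso_local_exact p i (kp_qiso Q))/eZ.
have [h hE] := cocycle_cmap cc.
exists (dhom_comp (dhom_map h) (dhom_inv (kp_qiso Q))).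
apply: deq_trans (deq_assoc _ _ _) _.
apply: (deq_trans (g := dhom_comp (dhom_map g) (dhom_inv (kp_qiso Q)))).
  apply: deq_comp (deq_refl _); apply: deq_trans (deq_sym (deq_map_comp _ _)) _.
  by apply: homotopic_deq; apply: boundary_sym; rewrite -cmap_cochain_comp hE.
apply: deq_trans (deq_comp (deq_sym fg) (deq_refl _)) _.
apply: deq_trans (deq_sym (deq_assoc _ _ _)) _.
by apply: deq_trans (deq_comp (deq_refl _) (deq_invr _)) (deq_idr _).
Qed.

(** The uniqueness half of the universal property, for endomorphisms of G: over a resolution Q of G
    it becomes injectivity on H^0 of Hom(Q, G) -> Hom(Q, I). *)
Lemma torsion_endo (w : dhom G G) :
  deq (dhom_comp (dhom_map j) w) (dhom_map j) -> deq w (dhom_id G).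
Proof.
move=> jw; pose Q := semifree_resolution G.
have [b wb] := dhom_K_projective w (kp_map Q) (@kp_projective _ _ Q).
have /(deq_homotopic (@kp_projective _ _ Q)) jbq :
    deq (dhom_map (cmap_comp j b)) (dhom_map (cmap_comp j (kp_map Q))).
  apply: deq_trans (deq_map_comp _ _) _.
  apply: deq_trans _ (deq_sym (deq_map_comp _ _)).
  apply: deq_trans (deq_comp (deq_refl _) (deq_sym wb)) _.
  by apply: deq_trans (deq_assoc _ _ _) _; apply: deq_comp jw (deq_refl _).
have bq : homotopic b (kp_map Q).
  have [|inj _] := @Hom_torsion_bij0 Q.
    move=> p nWp i; apply/(quasi_iso_local_exact p i (kp_qiso Q)).
    exact: torsion_cpx_local_exact.
  apply: inj; first by apply: cycleB; apply: cmap_cochain_cycle.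
  by rewrite linearB !cmap_cochain_comp.
have qq := kp_qiso Q.
apply: deq_trans (deq_sym (deq_idr _)) _.
apply: deq_trans (deq_comp (deq_refl _) (deq_sym (deq_invr qq))) _.
apply: deq_trans (deq_assoc _ _ _) _.
apply: deq_trans (deq_comp (deq_trans wb (homotopic_deq bq)) (deq_refl _)) _.
exact: deq_invr.
Qed.
End CounitFactorization.

Theorem theorem2p3 (R : comPzRingType) (noethR : noetherian R)
  (L : D R -> Prop) (smashingL : smashing L)
  (gamma : functor (D R) (full_subcategory L))
  (adj : adjunction (embedding L) gamma)
  (X I : cpx R) (n : int)
  (bounded_I : bounded I)
  (injective_I : forall i : int, injective_module (I i))
  (I_gt : forall i : int, n < i -> forall x : I i, x = 0)
  (X_trunc : L (trunc_le (-1) X))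
  (P : K_projective_resolution X) :
  isomorphism (fmap (sigma_gt R n) (fmap (RHom P) (counit adj I))).
Proof.
have [W [closedW LW]] := smashingL.
have LE Z : L Z <-> forall p, ~ W p -> forall i, local_exact p Z i.
  by rewrite LW; apply: supp_local_exact.
have [a [b I_out]] := bounded_I.
have I_lt i : i < a -> forall x : I i, x = 0 by move=> ia; apply: I_out; left.
pose psiP i := cid (torsion_retraction noethR closedW (injective_I i)).
pose psi i := sval (psiP i).
have psiT i x : torsion W (I i) (psi i x) by apply: (svalP (psiP i)).1.
have psi_id i x : torsion W (I i) x -> psi i x = x by apply: (svalP (psiP i)).2.
pose G := torsion_cpx W I; pose j : cmap G I := torsion_incl W I.
have LG : L G by apply/LE => p nWp i; apply: torsion_cpx_local_exact.
have [u uE] := adjoint_transpose adj (a := exist _ G LG)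
  (dhom_map j : hom (c := D R) _ _).
have [|v vE] := lift_torsion psiT psi_id injective_I I_lt I_gt (counit adj I).
  by apply/LE; apply: (svalP (gamma I)).
have v_iso : isomorphism (C := D R) (v : hom (c := D R) _ _).
  (* Both composites are tested against the maps to I: the counit detects [u v] by the adjunction,
     and [j] detects [v u] by [torsion_endo]. *)
  exists u; split.
    apply: (adjoint_inj (adj := adj) (a := gamma I)) => /=.
    apply: deq_trans (deq_assoc _ _ _) _.
    apply: deq_trans (deq_comp uE (deq_refl _)) _.
    exact: deq_trans vE (deq_sym (deq_idr _)).
  apply: (torsion_endo psiT psi_id injective_I I_lt I_gt).
  apply: deq_trans (deq_assoc _ _ _) _.
  exact: deq_trans (deq_comp vE (deq_refl _)) uE.
have jvE : heq (c := D R) (dhom_comp (dhom_map j) v) (counit adj I) := vE.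
apply: isomorphism_heq (fmap_heq (sigma_gt R n) (fmap_heq (RHom P) jvE)) _.
(* The counit is [j] after the isomorphism [v], so only the chain map induced by [j] remains. *)
apply: (isomorphism_compose (C := D R)); last first.
  exact: (isomorphism_fmap (sigma_gt R n) (isomorphism_fmap (RHom P) v_iso)).
apply: quasi_iso_isomorphism; apply: trunc_gt_qiso_above => i lt_ni.
(* The truncation of X at -1 gives torsion homology in degrees below 0, whence t = 0 and the bound n
   < i. *)
apply: (Hom_torsion_incl_bij psiT psi_id injective_I I_lt (t := 0) I_gt);
  last by lia.
move=> p nWp k lt_k0; apply/(quasi_iso_local_exact p k (@kp_qiso _ _ P)).
apply: (@trunc_le_local_exact _ _ (-1)); last by lia.
by move=> l; apply: (LE _).1 X_trunc p nWp l.
Qed.
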